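(* Let $q$ be a power of a prime $p$, $K$ the algebraic closure of $\mathbb{F}_q$, and let $m\geq 2$, $r\geq 2$ be integers with $p\nmid m$. Let $\alpha_1,\dots,\alpha_r\in K$ be pairwise distinct, let $\lambda_1,\dots,\lambda_r$ be integers with $1\leq \lambda_i<m$, put $\lambda_0:=\sum_{i=1}^r\lambda_i$, and assume $\gcd(m,\lambda_0)=1$. Let $\mathcal{X}$ be the curve over $K$ defined by $y^m=\prod_{i=1}^r (x-\alpha_i)^{\lambda_i}$, let $Q_\infty$ be its only place at infinity, and let $F_{H(Q_\infty)}$ be the Frobenius number of the Weierstrass semigroup $H(Q_\infty)$. Then the following two conditions are equivalent: (a) $F_{H(Q_\infty)}=m(r-1)-\lambda_0$ and $H(Q_\infty)$ is symmetric; (b) $\lambda_j\mid m$ for each $j=1,\dots,r$.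
   Context: $\mathcal{X}$ denotes the nonsingular projective irreducible curve over $K$ with function field $K(\mathcal{X})=K(x,y)$ given by the affine equation; $Q_\infty$ is the unique place of $K(\mathcal{X})$ lying over the pole of $x$ in $K(x)$ (unique since $\gcd(m,\lambda_0)=1$). For a place $Q$, the Weierstrass semigroup is $H(Q):=\{s\in\mathbb{N}_0 : (z)_\infty=sQ \text{ for some } z\in K(\mathcal{X})\}$, where $(z)_\infty$ is the pole divisor of $z$. The gap set is $G(Q):=\mathbb{N}\setminus H(Q)$; it has exactly $g(\mathcal{X})$ elements, where $g(\mathcal{X})$ is the genus. The Frobenius number $F_{H(Q)}$ is the largest element of $G(Q)$. $H(Q)$ is called symmetric if $F_{H(Q)}=2g(\mathcal{X})-1$. *)

(* Defs.v *)
From HB Require Import structures.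
From mathcomp Require Import all_boot all_order all_algebra all_field.
From mathcomp Require Import fraction.
From mathcomp Require Import boolp classical_sets.
From mathcomp.multinomials Require Import freeg.

Set Implicit Arguments.
Unset Strict Implicit.
Unset Printing Implicit Defensive.

Import Order.TTheory GRing.Theory Num.Theory.
Local Open Scope ring_scope.
Local Open Scope classical_set_scope.

(* A place of F / K, encoded by its normalized discrete valuation, which must
   be trivial on K.  The value at 0 (mathematically +oo) is set to 0 by
   convention, so that two places are equal iff their valuations agree;
   the valuation axioms only concern nonzero elements. *)
Record place (K : closedFieldType) (F : fieldType)
    (iota : {rmorphism K -> F}) := Place {
  vord : F -> int;
  vord0 : vord 0 = 0;
  vordM : forall a b : F, a != 0 -> b != 0 -> vord (a * b) = vord a + vord b;
  vordD : forall a b : F, a != 0 -> b != 0 -> a + b != 0 ->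
           Num.min (vord a) (vord b) <= vord (a + b);
  vord_const : forall c : K, c != 0 -> vord (iota c) = 0;
  vord_uniformizer : exists t : F, t != 0 /\ vord t = 1
}.

HB.instance Definition _ K F iota := gen_eqMixin (@place K F iota).
HB.instance Definition _ K F iota := gen_choiceMixin (@place K F iota).

Section FunctionField.
Variables (K : closedFieldType) (F : fieldType) (iota : {rmorphism K -> F}).

(* Since K is algebraically closed every place has degree 1, so the degree of
   a divisor is the sum of its coefficients, i.e. [deg] from freeg. *)
Definition divisor := {freeg (place iota) / int}.

Definition is_pole_divisor (z : F) (D : divisor) : Prop :=
  forall P : place iota, coeff P D = Num.max 0 (- vord P z).

Definition RR_space (A : divisor) : set F :=
  [set z | z <> 0 -> forall P : place iota, - coeff P A <= vord P z].

Definition has_dim (V : set F) (n : nat) : Prop :=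
  exists b : 'I_n -> F,
    [/\ forall i, V (b i),
        forall c : 'I_n -> K, \sum_i iota (c i) * b i = 0 -> forall i, c i = 0
      & forall z, V z -> exists c : 'I_n -> K, z = \sum_i iota (c i) * b i].

Definition ell (A : divisor) : nat :=
  xget 0%N [set n | has_dim (RR_space A) n].

(* g = max { deg A - ell A + 1 | A a divisor }, as in Riemann's theorem. *)
Definition is_genus (g : int) : Prop :=
  (exists A : divisor, g = deg A - (ell A)%:Z + 1) /\
  (forall A : divisor, deg A - (ell A)%:Z + 1 <= g).

Definition genus : int := xget 0 [set g | is_genus g].

Definition weierstrass_semigroup (Q : place iota) : set nat :=
  [set s | exists2 z : F, z != 0 & is_pole_divisor z << s%:Z *g Q >>].

Definition gap_set (Q : place iota) : set nat :=
  [set n | (0 < n)%N] `\` weierstrass_semigroup Q.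

(* Largest gap; the default -1 is the usual convention for the semigroup of
   all natural numbers, which has no gaps. *)
Definition frobenius_number (Q : place iota) : int :=
  xget (-1) [set f | exists n : nat,
    [/\ f = n%:Z, gap_set Q n & forall k, gap_set Q k -> (k <= n)%N]].

Definition symmetric_semigroup (Q : place iota) : Prop :=
  frobenius_number Q = 2%:Z * genus - 1.

End FunctionField.

(* A finite extension L of K(x) = {fraction {poly K}}, viewed as a function
   field over K: the constants K -> L and the element x. *)
Section FiniteExtension.
Variables (K : closedFieldType) (L : fieldExtType {fraction {poly K}}).

Definition const_emb : {rmorphism K -> L} :=
  in_alg L \o @FracField.tofrac {poly K} \o polyC.

Definition coord_x : L := in_alg L (FracField.tofrac 'X).

End FiniteExtension.

Arguments const_emb {K} L.
Arguments coord_x {K} L.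

(* Main.v *)
(** Write w(b) for the sum of the residues (b lambda_i mod m).  A function that
    is regular away from Q_infty has regular components c_b(x) y^b, because the
    automorphisms y -> zeta y permute the places; each component is a polynomial
    multiple of y^b / prod_i (x - alpha_i)^floor(b lambda_i / m), whose pole
    order at Q_infty is w(b).  So the w(b), 0 <= b < m, are the Apery set of
    H(Q_infty) with respect to m: the Frobenius number is max_b w(b) - m, and
    counting gaps gives 2g - 1 = m(r - 1) - sum_i gcd(m, lambda_i).  Hence
    symmetry together with F = m(r - 1) - lambda_0 says that the sum of the
    lambda_i equals that of the gcd(m, lambda_i), that is, lambda_i | m for all
    i; conversely, if lambda_i | m then each b lambda_i mod m is at most
    m - lambda_i, so w(b) is largest at b = m - 1.

    Since the genus is defined by Riemann's theorem over all divisors, it is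
    computed as follows.  Given A, take a polynomial h(x) dominating A at the
    finite places; L(A) is cut out of h^-1 L(M Q_infty), whose dimension is a
    count of semigroup elements, by at most as many linear conditions as the
    difference of degrees, and the sum of the v_P(h) over finite P is at most
    m deg h by weak approximation. *)
From HB Require Import structures.
Require Import Defs.
From mathcomp Require Import all_boot all_order all_algebra all_field.
From mathcomp Require Import fraction.
From mathcomp Require Import boolp classical_sets.
From mathcomp.multinomials Require Import freeg.
(* freeg redefines lift, hence fintype is imported again. *)
From mathcomp Require Import cyclic fintype zify ring.

Set Implicit Arguments.
Unset Strict Implicit.
Unset Printing Implicit Defensive.

Import Order.TTheory GRing.Theory Num.Theory.
Local Open Scope classical_set_scope.
Local Open Scope ring_scope.

(** * Valuations *)

Section Valuation.
Variables (K : closedFieldType) (F : fieldType) (iota : {rmorphism K -> F}).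
Implicit Types (P : place iota) (a b z : F).

(** A place is any normalized valuation trivial on [K], so centers, residues, ramification bounds
    and the existence of a place over each point have to be derived from the axioms. The main lever
    is that every element of [L] satisfies an equation over K(x) of bounded degree: nonzero terms of
    distinct orders cannot cancel, and two terms of equal order tie the order of the element to that
    of a rational function. At Q_infty the coprimality of m and lambda_0 makes the orders of the
    nonzero terms c_b y^b pairwise distinct, so a function has the order of one of its terms. This
    one fact gives the uniqueness of the place at infinity, its total ramification, the independence
    of the powers of y (hence degree m and the automorphisms y -> zeta y) and the orders that occur
    in H(Q_infty). Existence of places over finite points enters because a rational function is
    recognized as a polynomial by its regularity over every point of the line. *)

Lemma place_inj P P' : vord P =1 vord P' -> P = P'.
Proof.
case: P P' => [v ? ? ? ? ?] [v' ? ? ? ? ?] /= /funext vv'.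
by subst v'; f_equal; apply: Prop_irrelevance.
Qed.

Lemma vord1 P : vord P 1 = 0.
Proof.
have n1 : (1 : F) != 0 by apply: oner_neq0.
by have := vordM P n1 n1; rewrite mulr1; lia.
Qed.

Lemma vordV P a : vord P a^-1 = - vord P a.
Proof.
have [->|a0] := eqVneq a 0; first by rewrite invr0 vord0 oppr0.
have := vordM P a0 (invr_neq0 a0); rewrite divff // vord1; lia.
Qed.

Lemma vord_div P a b : a != 0 -> b != 0 -> vord P (a / b) = vord P a - vord P b.
Proof. by move=> a0 b0; rewrite vordM ?invr_neq0 // vordV. Qed.

Lemma vordX P a n : vord P (a ^+ n) = n%:Z * vord P a.
Proof.
have [->|a0] := eqVneq a 0.
  by case: n => [|n]; rewrite ?expr0 ?vord1 ?mul0r // exprS mul0r vord0 mulr0.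
elim: n => [|n IHn]; first by rewrite expr0 vord1 mul0r.
by rewrite exprS vordM ?expf_neq0 // IHn; lia.
Qed.

Lemma vord_prod P (I : Type) (s : seq I) (f : I -> F) :
    (forall i, f i != 0) ->
  vord P (\prod_(i <- s) f i) = \sum_(i <- s) vord P (f i).
Proof.
move=> f0; elim: s => [|i s IHs]; first by rewrite !big_nil vord1.
rewrite !big_cons vordM // ?IHs //.
by apply: (big_ind (fun z => z != 0)) => // [|a b]; [apply: oner_neq0 | apply: mulf_neq0].
Qed.

Lemma vordN P a : vord P (- a) = vord P a.
Proof.
have [->|a0] := eqVneq a 0; first by rewrite oppr0.
have N1 : (-1 : F) != 0 by rewrite oppr_eq0 oner_eq0.
rewrite -mulN1r vordM //.
have -> : (-1 : F) = iota (-1) by rewrite rmorphN rmorph1.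
by rewrite vord_const ?add0r // oppr_eq0 oner_eq0.
Qed.

(* vord P 0 = 0 is a junk value, so bounds on valuations go through vge. *)
Definition vge P (n : int) z := (z == 0) || (n <= vord P z).

Lemma vgeE P n z : z != 0 -> vge P n z = (n <= vord P z).
Proof. by rewrite /vge => /negPf ->. Qed.

Lemma vge0 P n : vge P n 0. Proof. by rewrite /vge eqxx. Qed.

Lemma vge_vord P z : vge P (vord P z) z. Proof. by rewrite /vge lexx orbT. Qed.

Lemma vgeW P n n' z : n' <= n -> vge P n z -> vge P n' z.
Proof. by rewrite /vge; case: eqP => //= _; apply: le_trans. Qed.

Lemma vgeD P n a b : vge P n a -> vge P n b -> vge P n (a + b).
Proof.
rewrite /vge; case: (eqVneq a 0) => [->|a0] /=; first by rewrite add0r.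
case: (eqVneq b 0) => [->|b0] /=; first by rewrite addr0 => ->; rewrite orbT.
move=> na nb; case: (eqVneq (a + b) 0) => //= ab0.
by have := vordD P a0 b0 ab0; lia.
Qed.

Lemma vgeN P n a : vge P n (- a) = vge P n a.
Proof. by rewrite /vge oppr_eq0 vordN. Qed.

Lemma vgeB P n a b : vge P n a -> vge P n b -> vge P n (a - b).
Proof. by move=> na nb; rewrite vgeD ?vgeN. Qed.

Lemma vgeM P n n' a b : vge P n a -> vge P n' b -> vge P (n + n') (a * b).
Proof.
rewrite /vge mulf_eq0; case: (eqVneq a 0) => //= a0.
case: (eqVneq b 0) => //= b0 na nb; rewrite vordM //; lia.
Qed.

Lemma vgeMl P n a z : a != 0 -> vge P (vord P a + n) (a * z) = vge P n z.
Proof.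
move=> a0; rewrite /vge mulf_eq0 (negPf a0); case: (eqVneq z 0) => //= z0.
by rewrite vordM // lerD2l.
Qed.

Lemma vge_const P c : vge P 0 (iota c).
Proof.
have [->|c0] := eqVneq c 0; first by rewrite rmorph0 vge0.
by rewrite /vge vord_const // lexx orbT.
Qed.

Lemma vgeX P a n : vge P 0 a -> vge P 0 (a ^+ n).
Proof.
move=> a0; elim: n => [|n IHn]; first by rewrite expr0 /vge vord1 lexx orbT.
by rewrite exprS -[0]addr0 vgeM.
Qed.

Lemma vge_sum P n (I : Type) (r : seq I) (p : pred I) (f : I -> F) :
  (forall i, p i -> vge P n (f i)) -> vge P n (\sum_(i <- r | p i) f i).
Proof. by move=> nf; apply: (big_ind (vge P n)) => [|a b|//]; [apply: vge0 | apply: vgeD]. Qed.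

Lemma vord_domD P a b : a != 0 -> vge P (vord P a + 1) b ->
  a + b != 0 /\ vord P (a + b) = vord P a.
Proof.
move=> a0 ab; have [->|b0] := eqVneq b 0; first by rewrite addr0.
move: ab; rewrite vgeE // => ab.
have ab0 : a + b != 0.
  apply/negP; rewrite addr_eq0 => /eqP ea.
  by have := vordN P b; rewrite -ea; lia.
split=> //; have := vordD P a0 b0 ab0.
have Nb0 : - b != 0 by rewrite oppr_eq0.
by have := vordD P ab0 Nb0; rewrite addrK vordN => /(_ a0); lia.
Qed.

Lemma vord_dom_sum P (I : finType) (f : I -> F) (i0 : I) : f i0 != 0 ->
    (forall i, i != i0 -> vge P (vord P (f i0) + 1) (f i)) ->
  \sum_i f i != 0 /\ vord P (\sum_i f i) = vord P (f i0).
Proof. by move=> fi0 dom; rewrite (bigD1 i0) //=; apply/vord_domD/vge_sum. Qed.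

(** Units at [P] are units at [P']; since z / t ^ v(z) is such a unit, v' is v multiplied by v'(t).
    As v' takes the value 1, that factor is 1. *)
Lemma place_eq_of_le P P' : (forall z, z != 0 -> 0 <= vord P z -> 0 <= vord P' z) ->
  P = P'.
Proof.
move=> le; have unit z : z != 0 -> vord P z = 0 -> vord P' z = 0.
  move=> z0 vz; have := le _ z0; rewrite vz => /(_ isT).
  by have := le _ (invr_neq0 z0); rewrite !vordV vz => /(_ isT); lia.
have [t [t0 vt]] := vord_uniformizer P.
have [t' [t'0 vt']] := vord_uniformizer P'.
have main z : z != 0 -> vord P' z = vord P z * vord P' t.
  move=> z0; case vz: (vord P z) => [n|n].
    have := unit (z / t ^+ n); rewrite mulf_neq0 ?invr_neq0 ?expf_neq0 //.
    rewrite !vordM ?invr_neq0 ?expf_neq0 // !vordV !vordX vt vz.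
    by move=> /(_ isT) h; have := h _; lia.
  have := unit (z * t ^+ n.+1); rewrite mulf_neq0 ?expf_neq0 //.
  rewrite !vordM ?expf_neq0 // !vordX vt vz.
  by move=> /(_ isT) h; have := h _; lia.
have vt1 : vord P' t = 1.
  have := main t' t'0; have := le t t0; rewrite vt vt' => /(_ isT) vt_ge0.
  by have [vt'_gt0|vt'_le0] := ltrP 0 (vord P t'); nia.
apply: place_inj => z; have [->|z0] := eqVneq z 0; first by rewrite !vord0.
by rewrite main // vt1 mulr1.
Qed.

End Valuation.

(** * Weak approximation *)

Section Approximation.
Variables (K : closedFieldType) (F : fieldType) (iota : {rmorphism K -> F}).
Implicit Types (P : place iota) (a b z : F).

Lemma place_separation P P' : P != P' ->
  exists z, [/\ z != 0, 0 <= vord P z & vord P' z < 0].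
Proof.
move=> PP'; apply: contrapT => nz; case/eqP: PP'; apply: place_eq_of_le => z z0 vz.
by rewrite leNgt; apply/negP => v'z; apply: nz; exists z.
Qed.

Lemma strict_place_separation P P' : P != P' ->
  exists z, [/\ z != 0, 0 < vord P z & vord P' z < 0].
Proof.
move=> PP'; have [y [y0 vy v'y]] := place_separation PP'.
rewrite eq_sym in PP'; have [z [z0 v'z vz]] := place_separation PP'.
exists (y / z); rewrite mulf_neq0 ?invr_neq0 // !vordM ?invr_neq0 // !vordV.
by split=> //; lia.
Qed.

Lemma places_separation P (s : seq (place iota)) : P \notin s ->
  exists z, [/\ z != 0, 0 < vord P z & forall P', P' \in s -> vord P' z < 0].
Proof.
elim: s => [_|P1 s IHs].
  by have [t [t0 vt]] := vord_uniformizer P; exists t; rewrite vt; split.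
rewrite inE negb_or => /andP[PP1 /IHs [y [y0 vy sy]]].
have [v1y|v1y] := ltrP (vord P1 y) 0.
  by exists y; split=> // P'; rewrite inE => /orP[/eqP ->|/sy].
have [z [z0 vz v1z]] := strict_place_separation PP1.
have [r rs] : exists r : nat, forall P', P' \in s -> - (r%:Z) < vord P' y.
  exists (\max_(P' <- s) `|vord P' y|%N).+1 => P' P's.
  by have := @leq_bigmax_seq _ s xpredT (fun P' => `|vord P' y|%N) _ P's isT; rewrite /=; lia.
(* The exponent exceeds every pole order of [y] on [s]: where [z] has a pole, [zr] dominates [y],
   and elsewhere on [s] the pole of [y] dominates. So no pole is cancelled in [zr + y]. *)
pose zr := z ^+ r.+1; have zr0 : zr != 0 by apply: expf_neq0.
have vzr P' : vord P' zr = r.+1%:Z * vord P' z.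
  by rewrite vordX.
have vzr_lt0 P' : vord P' z < 0 -> vord P' zr <= - r.+1%:Z.
  by rewrite vzr; nia.
have vzr_ge0 P' : 0 <= vord P' z -> vord P' z <= vord P' zr.
  by rewrite vzr; nia.
have := vzr_lt0 _ v1z; have := vzr_ge0 _ (ltW vz) => {vzr} vr v1r.
have [u0 v1u] : zr + y != 0 /\ vord P1 (zr + y) = vord P1 zr.
  by apply: vord_domD; rewrite // vgeE // ; lia.
exists (zr + y); split=> [//||P'].
  have : vge P 1 (zr + y) by rewrite vgeD // vgeE // ; lia.
  by rewrite vgeE.
rewrite inE => /orP[/eqP ->|P's]; first by rewrite v1u; lia.
have yP' := sy _ P's; have rP' := rs _ P's.
have [zP'|zP'] := ltrP (vord P' z) 0.
  have := vzr_lt0 _ zP' => zrP'.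
  have [] : zr + y != 0 /\ vord P' (zr + y) = vord P' zr.
    by apply: vord_domD; rewrite // vgeE // ; lia.
  by move=> _ ->; lia.
have := vzr_ge0 _ zP' => zrP'.
have [] : y + zr != 0 /\ vord P' (y + zr) = vord P' y.
  by apply: vord_domD; rewrite // vgeE // ; lia.
by rewrite addrC => _ ->.
Qed.

(** If z vanishes at [P] and has poles on [s], then 1 / (1 + z) is a unit at [P] and vanishes on
    [s]. *)
Lemma weak_approximation P (s : seq (place iota)) : P \notin s ->
  exists z, [/\ z != 0, vord P z = 0 & forall P', P' \in s -> 0 < vord P' z].
Proof.
move=> /places_separation [z [z0 vz sz]].
have n1 : (1 : F) != 0 by apply: oner_neq0.
have [u0 vu] : 1 + z != 0 /\ vord P (1 + z) = vord P 1.
  by apply: vord_domD; rewrite // vgeE // vord1; lia.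
exists (1 + z)^-1; rewrite invr_neq0 // vordV vu vord1 oppr0; split=> // P' P's.
have zP' := sz _ P's; rewrite vordV.
have [] : z + 1 != 0 /\ vord P' (z + 1) = vord P' z.
  by apply: vord_domD; rewrite // vgeE // vord1; lia.
by rewrite addrC => _ ->; lia.
Qed.

End Approximation.

(** * Dimensions *)

Section Dimension.
Variables (K : closedFieldType) (F : fieldType) (iota : {rmorphism K -> F}).
Implicit Types (V W : set F).

Definition lin_closed V := forall c a b, V a -> V b -> V (iota c * a + b).

Lemma has_dim_inj V n n' : has_dim iota V n -> has_dim iota V n' -> n = n'.
Proof.
suff le k k' : has_dim iota V k -> has_dim iota V k' -> (k <= k')%N.
  by move=> d d'; apply/eqP; rewrite eqn_leq !le.
move=> [b [Vb freeb _]] [b' [_ _ spanb']].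
have /choice [C bC] : forall i, exists c : 'I_k' -> K, b i = \sum_j iota (c j) * b' j.
  by move=> i; apply/spanb'/Vb.
pose M := \matrix_(i, j) C i j.
have freeM : row_free M.
  rewrite -kermx_eq0; apply/rowV0P => u /sub_kermxP uM.
  apply/rowP => i; rewrite mxE; apply: (freeb (u 0)).
  transitivity (\sum_j iota ((u *m M) 0 j) * b' j); last first.
    by rewrite uM big1 // => j _; rewrite mxE rmorph0 mul0r.
  under eq_bigr do rewrite bC mulr_sumr.
  rewrite exchange_big /=; apply: eq_bigr => j _.
  rewrite mxE rmorph_sum mulr_suml; apply: eq_bigr => i' _.
  by rewrite mxE rmorphM mulrA.
by rewrite -(eqP freeM) rank_leq_col.
Qed.

Lemma lin_closed0 V a : lin_closed V -> V a -> V 0.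
Proof.
by move=> linV Va; have := linV (-1) a a Va Va; rewrite rmorphN rmorph1 mulN1r addNr.
Qed.

Lemma lin_closed_sum V (I : finType) (c : I -> K) (b : I -> F) :
    lin_closed V -> V 0 -> (forall i, V (b i)) ->
  V (\sum_i iota (c i) * b i).
Proof.
by move=> linV V0 Vb; apply: big_rec => // i a _ Va; apply: linV.
Qed.

Lemma has_dim_extend V W n z0 : lin_closed V -> V `<=` W ->
    W z0 -> ~ V z0 -> (forall w, W w -> exists c, V (w - iota c * z0)) ->
  has_dim iota V n -> has_dim iota W n.+1.
Proof.
move=> linV VW Wz0 Vz0 Wz [b [Vb freeb spanb]].
have V0 : V 0 by have [c /lin_closed0] := Wz _ Wz0; apply.
pose b1 i := oapp b z0 (unlift ord0 i).
have b1E (c : 'I_n.+1 -> K) : \sum_i iota (c i) * b1 i =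
    iota (c ord0) * z0 + \sum_i iota (c (lift ord0 i)) * b i.
  rewrite big_ord_recl {1}/b1 unlift_none /=; congr (_ + _).
  by apply: eq_bigr => i _; rewrite /b1 liftK.
exists b1; split=> [i|c|w /Wz[c Vw]].
- by rewrite /b1; case: unliftP => [j|] _ //=; apply: VW.
- rewrite b1E => c0b.
  have c0 : c ord0 = 0.
    apply: contra_notP Vz0 => /eqP c0.
    have -> : z0 = \sum_i iota (- (c ord0)^-1 * c (lift ord0 i)) * b i.
      under eq_bigr do rewrite rmorphM -mulrA.
      rewrite -mulr_sumr -(addKr (iota (c ord0) * z0) (\sum_i _)) c0b addr0.
      by rewrite mulrN rmorphN mulNr opprK mulrA -rmorphM mulVf // rmorph1 mul1r.
    exact: lin_closed_sum.
  move: c0b; rewrite c0 rmorph0 mul0r add0r => /freeb cl i.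
  by case: (unliftP ord0 i) => [j|] ->.
have [d wE] := spanb _ Vw.
exists (fun i => oapp d c (unlift ord0 i)); rewrite b1E unlift_none /=.
by under eq_bigr do rewrite liftK /=; rewrite -wE addrC subrK.
Qed.

(** The last condition says that [V] has codimension at most 1 in [W]. A basis vector outside [V]
    can be subtracted, with suitable multiples, from the others to move them into [V], where they
    form a basis. *)
Lemma has_dim_hyperplane V W n : lin_closed V -> lin_closed W -> V `<=` W -> V 0 ->
    (forall z w, W z -> W w -> ~ V z -> exists c, V (w - iota c * z)) ->
  has_dim iota W n -> exists2 k, has_dim iota V k & (n <= k.+1)%N.
Proof.
move=> linV linW VW V0 hyp [b [Wb freeb spanb]].
have [Vb|] := pselect (forall i, V (b i)).
  exists n => //; exists b; split=> // z Vz; exact/spanb/VW.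
move=> /existsNP [k Vbk].
case: n b Wb freeb spanb k Vbk => [|n] b Wb freeb spanb k Vbk; first by case: k Vbk.
have /choice [c Vc] : forall i, exists c, V (b (lift k i) - iota c * b k).
  by move=> i; apply: hyp.
exists n => //; exists (fun i => b (lift k i) - iota (c i) * b k).
have sumE (d : 'I_n.+1 -> K) : \sum_i iota (d i) * b i =
    iota (d k + \sum_i d (lift k i) * c i) * b k +
    \sum_i iota (d (lift k i)) * (b (lift k i) - iota (c i) * b k).
  under [X in _ = _ + X]eq_bigr do rewrite mulrBr.
  rewrite sumrB rmorphD rmorph_sum mulrDl -addrA mulr_suml.
  under [X in _ = _ + (X + _)]eq_bigr do rewrite rmorphM -mulrA.
  rewrite [X in _ = _ + X]addrCA subrr addr0.
  by rewrite (bigD1_ord k).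
split=> // [d d0|z Vz].
  pose d1 i := oapp d (- \sum_i d i * c i) (unlift k i).
  have d1E i : d1 (lift k i) = d i by rewrite /d1 liftK.
  have: \sum_i iota (d1 i) * b i = 0.
    rewrite sumE; under [X in _ + X]eq_bigr do rewrite d1E.
    rewrite d0 addr0; under eq_bigr do rewrite d1E.
    by rewrite /d1 unlift_none /= addNr rmorph0 mul0r.
  by move/freeb => d1_0 i; rewrite -d1E.
have [d zE] := spanb _ (VW _ Vz).
exists (d \o lift k) => /=; rewrite zE sumE.
set e := d k + _; have -> : e = 0; last by rewrite rmorph0 mul0r add0r.
(* Were [e] nonzero, the expansion of [z] could be solved for [b k], which would then lie in [V]. *)
apply: contra_notP Vbk => /eqP e0.
have -> : b k = iota e^-1 * (z + \sum_i iota (- d (lift k i)) *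
    (b (lift k i) - iota (c i) * b k)).
  rewrite zE sumE -/e -addrA -big_split /= big1 => [|i _]; last first.
    by rewrite -mulrDl -rmorphD subrr rmorph0 mul0r.
  by rewrite addr0 mulrA -rmorphM mulVf // rmorph1 mul1r.
rewrite -[X in V X]addr0; apply: (linV) => //.
rewrite -[z]mul1r -(rmorph1 iota); apply: (linV) => //.
exact: lin_closed_sum.
Qed.

Lemma has_dim0 : has_dim iota [set 0] 0.
Proof.
exists (fun i => 0); split=> [//|c _ []//|z ->].
by exists (fun=> 0); rewrite big_ord0.
Qed.

Lemma has_dim_scale V n h : h != 0 -> has_dim iota V n ->
  has_dim iota [set z | V (h * z)] n.
Proof.
move=> h0 [b [Vb freeb spanb]]; exists (fun i => h^-1 * b i); split=> [i|c|z /spanb].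
- by rewrite /= mulVKf.
- under eq_bigr do rewrite mulrCA.
  by rewrite -mulr_sumr => /eqP; rewrite mulf_eq0 invr_eq0 (negPf h0) => /eqP /freeb.
move=> [c hz]; exists c; under eq_bigr do rewrite mulrCA.
by rewrite -mulr_sumr -hz mulKf.
Qed.

End Dimension.

(** * The rational subfield *)

(* Keeps simplification from unfolding const_emb. *)
#[local] Arguments GRing.RMorphism.sort : simpl never.

Section RationalSubfield.
Variables (K : closedFieldType) (L : fieldExtType {fraction {poly K}}).
Local Notation place := (place (const_emb L)).
Implicit Types (P : place) (p : {poly K}) (a : {fraction {poly K}}) (z : L).

Definition frac_emb : {rmorphism {fraction {poly K}} -> L} := in_alg L.

Definition poly_emb : {rmorphism {poly K} -> L} :=
  frac_emb \o @FracField.tofrac {poly K}.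

Lemma poly_embC c : poly_emb c%:P = const_emb L c. Proof. by []. Qed.

Lemma poly_embX : poly_emb 'X = coord_x L. Proof. by []. Qed.

Lemma poly_embXsubC b : poly_emb ('X - b%:P) = coord_x L - const_emb L b.
Proof. by rewrite rmorphB. Qed.

Lemma poly_emb_eq0 p : (poly_emb p == 0) = (p == 0).
Proof. by rewrite fmorph_eq0 tofrac_eq0. Qed.

Lemma coord_xB_neq0 b : coord_x L - const_emb L b != 0.
Proof. by rewrite -poly_embXsubC poly_emb_eq0 polyXsubC_eq0. Qed.

Lemma fracP a : exists n d : {poly K}, d != 0 /\ frac_emb a = poly_emb n / poly_emb d.
Proof.
elim/quotW: a => x; exists (\n_x), (\d_x).
have tofracE p : (@FracField.tofrac {poly K} : {rmorphism _ -> _}) p =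
    (\pi_{fraction {poly K}} (Ratio p 1))%qT.
  by rewrite -[LHS]/(FracField.tofrac p); unlock FracField.tofrac.
have dx : \d_x != 0 by apply: denom_ratioP.
split=> //; apply/eqP; rewrite -(can2_eq (mulfK _) (divfK _)) ?poly_emb_eq0 //.
rewrite -rmorphM; apply/eqP; congr (frac_emb _).
transitivity (\pi_{fraction {poly K}} (FracField.mulf x (Ratio \d_x 1)))%qT.
  by rewrite FracField.pi_mul tofracE.
rewrite tofracE; apply/eqmodP; rewrite /= FracField.equivfE /FracField.mulf.
by rewrite !numden_Ratio ?mulf_neq0 ?oner_eq0 // !mulr1 mulrC.
Qed.

(** The degree bound, uniform in [z], later provides one exponent that works for the orders of all
    elements at once. *)
Lemma algebraic_relation z : exists2 p : {poly {fraction {poly K}}},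
  p != 0 /\ (size p <= (\dim {:L}).+1)%N &
  \sum_(i < size p) frac_emb p`_i * z ^+ i = 0.
Proof.
have /polyOver1P [p pE] := minPolyOver 1 z.
have sp : size p = size (minPoly 1 z) by rewrite pE size_map_poly.
exists p.
  split; first by rewrite -size_poly_eq0 sp size_poly_eq0 monic_neq0 ?monic_minPoly.
  rewrite sp size_minPoly ltnS.
  by have := dim_Fadjoin 1%AS z; rewrite dimv1 muln1 => <-; rewrite dimvS ?subvf.
have /eqP := root_minPoly 1 z; rewrite pE horner_coef size_map_poly => {2}<-.
by apply: eq_bigr => i _; rewrite coef_map.
Qed.

Lemma vord_expz P z (n : int) : z != 0 -> vord P (z ^ n) = n * vord P z.
Proof.
move=> z0; case: n => n; first by rewrite -exprnP vordX.
by rewrite NegzE -exprnN vordV vordX; lia.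
Qed.

Lemma coord_x_neq0 : coord_x L != 0.
Proof. by have := coord_xB_neq0 0; rewrite rmorph0 subr0. Qed.

Lemma frac_emb_neq0 a : a != 0 -> frac_emb a != 0.
Proof. by rewrite fmorph_eq0. Qed.

Lemma vge_poly P p : 0 <= vord P (coord_x L) -> vge P 0 (poly_emb p).
Proof.
move=> vx; elim/poly_ind: p => [|p c IHp]; first by rewrite rmorph0 vge0.
rewrite rmorphD rmorphM vgeD ?vge_const // -[0]addr0 vgeM //.
by rewrite vgeE ?coord_x_neq0.
Qed.

Lemma vord_coord_x_ge0 P b : 0 < vord P (coord_x L - const_emb L b) ->
  0 <= vord P (coord_x L).
Proof.
move=> vb; rewrite -vgeE ?coord_x_neq0 // -(subrK (const_emb L b) (coord_x L)).
by rewrite vgeD ?vge_const // vgeE ?coord_xB_neq0 // ltW.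
Qed.

Lemma vord_poly_unit P b p : 0 < vord P (coord_x L - const_emb L b) ->
  p.[b] != 0 -> vord P (poly_emb p) = 0.
Proof.
move=> vb pb0; have /factor_theorem [q pE] : root (p - p.[b]%:P) b.
  by rewrite /root !hornerE subrr.
have -> : p = p.[b]%:P + q * ('X - b%:P) by rewrite -pE addrC subrK.
rewrite rmorphD poly_embC; have vc := vord_const P pb0.
have [||_ ->] // := @vord_domD _ _ _ P (const_emb L p.[b]) (poly_emb (q * ('X - b%:P))).
  by rewrite fmorph_eq0.
rewrite vc rmorphM poly_embXsubC vgeM ?vge_poly ?(vord_coord_x_ge0 vb) //.
by rewrite vgeE ?coord_xB_neq0 //; lia.
Qed.

Lemma vord_coord_xB P b b' : 0 < vord P (coord_x L - const_emb L b) ->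
  b != b' -> vord P (coord_x L - const_emb L b') = 0.
Proof.
move=> vb bb'; rewrite -poly_embXsubC (vord_poly_unit vb) //.
by rewrite !hornerE subr_eq0.
Qed.

Lemma local_form b a : a != 0 -> exists (w : int) (n d : {poly K}),
  [/\ n.[b] != 0, d.[b] != 0 &
      frac_emb a = (coord_x L - const_emb L b) ^ w * (poly_emb n / poly_emb d)].
Proof.
move=> a0; have [n [d [d0 aE]]] := fracP a.
have n0 : n != 0.
  apply: contra_neq a0 => n0; apply/eqP.
  by have /eqP := aE; rewrite n0 rmorph0 mul0r fmorph_eq0.
have [k [n' + nE]] := multiplicity_XsubC n b; rewrite n0 /= => n'b.
have [l [d' + dE]] := multiplicity_XsubC d b; rewrite d0 /= => d'b.
have x0 : coord_x L - const_emb L b != 0 by apply: coord_xB_neq0.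
exists (k%:Z - l%:Z), n', d'; split=> //.
rewrite aE nE dE !rmorphM !rmorphXn /= poly_embXsubC expfzDr // -exprnN -exprnP.
by rewrite invfM mulrACA mulrC.
Qed.

(** The exponent [w] must precede [P]: in the fundamental inequality it is minimized before the
    place at which the sum is examined is known. *)
Lemma vord_frac b a : a != 0 -> exists w : int,
  forall P, 0 < vord P (coord_x L - const_emb L b) ->
    vord P (frac_emb a) = w * vord P (coord_x L - const_emb L b).
Proof.
move=> a0; have [w [n [d [nb db ->]]]] := local_form b a0.
have nz p : p.[b] != 0 -> poly_emb p != 0.
  by rewrite poly_emb_eq0; apply: contra_neq => ->; rewrite horner0.
have x0 : coord_x L - const_emb L b != 0 by apply: coord_xB_neq0.
exists w => P vb; rewrite !vordM ?mulf_neq0 ?invr_neq0 ?nz ?expfz_neq0 //.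
by rewrite vordV !(vord_poly_unit vb) // vord_expz //; lia.
Qed.

Lemma frac_residue_finite P b a : 0 < vord P (coord_x L - const_emb L b) ->
  vge P 0 (frac_emb a) -> exists c, vge P 1 (frac_emb a - const_emb L c).
Proof.
move=> vb; have [->|a0] := eqVneq a 0.
  by exists 0; rewrite !rmorph0 subrr vge0.
have [w [n [d [nb db aE]]]] := local_form b a0.
have [w' vE] := vord_frac b a0.
have nz p : p.[b] != 0 -> poly_emb p != 0.
  by rewrite poly_emb_eq0; apply: contra_neq => ->; rewrite horner0.
have x0 : coord_x L - const_emb L b != 0 by apply: coord_xB_neq0.
have w'E : vord P (frac_emb a) = w * vord P (coord_x L - const_emb L b).
  rewrite aE !vordM ?mulf_neq0 ?invr_neq0 ?nz ?expfz_neq0 //.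
  by rewrite vordV !(vord_poly_unit vb) // vord_expz //; lia.
rewrite vgeE ?frac_emb_neq0 // w'E => ve.
have [w0|w0] := eqVneq w 0; last first.
  exists 0; rewrite rmorph0 subr0 vgeE ?frac_emb_neq0 // w'E.
  have : 0 < w by rewrite lt_neqAle eq_sym w0 -(pmulr_lge0 _ vb).
  by nia.
exists (n.[b] / d.[b]); rewrite aE w0 expr0z mul1r.
have /factor_theorem [q qE] : root (n - (n.[b] / d.[b])%:P * d) b.
  by rewrite /root !hornerE divfK // subrr.
have -> : poly_emb n / poly_emb d - const_emb L (n.[b] / d.[b]) =
    poly_emb q / poly_emb d * (coord_x L - const_emb L b).
  apply: (mulIf (nz _ db)); rewrite mulrBl divfK ?nz // mulrAC divfK ?nz //.
  by rewrite -poly_embC -poly_embXsubC -!rmorphM -rmorphB qE.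
rewrite -[1]add0r vgeM //; last by rewrite vgeE ?coord_xB_neq0 //; lia.
rewrite -[0]addr0 vgeM ?vge_poly ?(vord_coord_x_ge0 vb) //.
by rewrite vgeE ?invr_neq0 ?nz // vordV (vord_poly_unit vb).
Qed.

Lemma vord_poly_infinite P p : vord P (coord_x L) < 0 -> p != 0 ->
  vord P (poly_emb p) = (size p).-1%:Z * vord P (coord_x L).
Proof.
move=> vx; elim/poly_ind: p => [|p c IHp]; first by rewrite eqxx.
have x0 := coord_x_neq0; have [->|p0 _] := eqVneq p 0.
  rewrite mul0r add0r polyC_eq0 => c0.
  by rewrite poly_embC vord_const // size_polyC c0 mul0r.
have px0 : poly_emb (p * 'X) != 0 by rewrite poly_emb_eq0 mulf_neq0 ?polyX_eq0.
have sp : (0 < size p)%N by rewrite size_poly_gt0.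
have vpx : vord P (poly_emb (p * 'X)) = (size p)%:Z * vord P (coord_x L).
  by rewrite rmorphM vordM ?poly_emb_eq0 ?polyX_eq0 // IHp // poly_embX; nia.
rewrite rmorphD size_MXaddC (negPf p0) /= -vpx.
have [||//] := @vord_domD _ _ _ P (poly_emb (p * 'X)) (poly_emb c%:P) => //.
by apply: (@vgeW _ _ _ _ 0); rewrite ?vge_const // vpx; nia.
Qed.

Lemma frac_residue_infinite P a : vord P (coord_x L) < 0 ->
  vge P 0 (frac_emb a) -> exists c, vge P 1 (frac_emb a - const_emb L c).
Proof.
move=> vx; have [n [d [d0 aE]]] := fracP a.
have [n0|n0] := eqVneq n 0.
  by exists 0; rewrite aE n0 !rmorph0 mul0r subr0 vge0.
have dx0 : poly_emb d != 0 by rewrite poly_emb_eq0.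
have nx0 : poly_emb n != 0 by rewrite poly_emb_eq0.
have sn : (0 < size n)%N by rewrite size_poly_gt0.
have sd : (0 < size d)%N by rewrite size_poly_gt0.
have lt (p q : {poly K}) : (size p < size q)%N -> vge P 1 (poly_emb p / poly_emb q).
  have [->|p0 spq] := eqVneq p 0; first by rewrite rmorph0 mul0r vge0.
  have sp : (0 < size p)%N by rewrite size_poly_gt0.
  have q0 : q != 0 by rewrite -size_poly_gt0 (leq_ltn_trans _ spq).
  have px0 : poly_emb p != 0 by rewrite poly_emb_eq0.
  have qx0 : poly_emb q != 0 by rewrite poly_emb_eq0.
  rewrite vgeE ?mulf_neq0 ?(invr_neq0 qx0) // (vord_div P px0 qx0).
  rewrite (vord_poly_infinite vx p0) (vord_poly_infinite vx q0) -mulrBl.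
  have : (size p).-1%:Z - (size q).-1%:Z <= -1 by lia.
  by move: (_ - _) (vord P _) vx => u v; nia.
rewrite aE vgeE ?mulf_neq0 ?(invr_neq0 dx0) // (vord_div P nx0 dx0).
rewrite (vord_poly_infinite vx n0) (vord_poly_infinite vx d0) -mulrBl => ve.
have [snd|snd] := ltnP (size n) (size d).
  by exists 0; rewrite rmorph0 subr0 lt.
have {ve snd} snd : size n = size d.
  have : (size n).-1%:Z - (size d).-1%:Z <= 0.
    by move: (_ - _) (vord P _) vx ve => u v; nia.
  by lia.
pose c := lead_coef n / lead_coef d; exists c.
have -> : poly_emb n / poly_emb d - const_emb L c =
    poly_emb (n - c *: d) / poly_emb d.
  apply: (mulIf dx0); rewrite mulrBl !divfK // -poly_embC -rmorphM -rmorphB.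
  by rewrite mul_polyC.
apply: lt; rewrite ltn_neqAle; apply/andP; split; last first.
  rewrite (leq_trans (size_polyD _ _)) // geq_max snd leqnn size_polyN.
  by rewrite (leq_trans (size_scale_leq _ _)).
apply/negP => /eqP sE.
have : lead_coef (n - c *: d) = 0.
  rewrite lead_coefE sE coefB coefZ -[d`__]/(lead_coef d) -snd -[n`__]/(lead_coef n).
  by rewrite divfK ?subrr // lead_coef_eq0.
move/eqP; rewrite lead_coef_eq0 => /eqP nc0.
by move: sE; rewrite nc0 size_poly0; lia.
Qed.

End RationalSubfield.

(** * Centers and residues *)

Section Places.
Variables (K : closedFieldType) (L : fieldExtType {fraction {poly K}}).
Local Notation place := (place (const_emb L)).
Local Notation frac_emb := (frac_emb L).
Local Notation poly_emb := (poly_emb L).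
Local Notation x_sub b := (coord_x L - const_emb L b).
Implicit Types (P : place) (p : {poly K}) (a : {fraction {poly K}}) (z : L).

(** Otherwise every x - b is a unit at [P], and by factoring polynomials over [K] all of K(x) has
    order 0. In the equation of a uniformizer t over K(x), the term of degree k then has order k, so
    the terms cannot cancel. *)
Lemma place_center P : 0 <= vord P (coord_x L) -> exists b, 0 < vord P (x_sub b).
Proof.
move=> vx; apply: contrapT => nb.
have vb b : vord P (x_sub b) = 0.
  apply/eqP; rewrite eq_le; apply/andP; split.
    by rewrite leNgt; apply/negP => vb; apply: nb; exists b.
  rewrite -vgeE ?coord_xB_neq0 // vgeB ?vge_const //.
  by rewrite vgeE ?coord_x_neq0.
have vp p : p != 0 -> vord P (poly_emb p) = 0.
  move=> p0; have [r pE] := closed_field_poly_normal p.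
  have lp0 : lead_coef p != 0 by rewrite lead_coef_eq0.
  rewrite pE -mul_polyC rmorphM vordM ?poly_emb_eq0 ?polyC_eq0 //; last first.
    by rewrite prodf_seq_neq0; apply/allP => c _; rewrite polyXsubC_eq0.
  rewrite poly_embC vord_const // rmorph_prod vord_prod => [|c].
    by rewrite big1 ?addr0 // => c _; rewrite poly_embXsubC.
  by rewrite poly_embXsubC coord_xB_neq0.
have va a : a != 0 -> vord P (frac_emb a) = 0.
  move=> a0; have [n [d [d0 aE]]] := fracP L a.
  have dx0 : poly_emb d != 0 by rewrite poly_emb_eq0.
  have : frac_emb a != 0 by apply: frac_emb_neq0.
  rewrite aE mulf_eq0 negb_or => /andP[nx0 _].
  rewrite (vord_div P nx0 dx0) !vp //.
  by move: nx0; rewrite poly_emb_eq0.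
have [t [t0 vt]] := vord_uniformizer P.
have [q [q0 _] qt] := algebraic_relation t.
have sq : (0 < size q)%N by rewrite size_poly_gt0.
pose i0 := Ordinal (ltac:(by rewrite prednK) : ((size q).-1 < size q)%N).
have qi0 : q`_i0 != 0 by rewrite -[q`_i0]/(lead_coef q) lead_coef_eq0.
case: (arg_minnP (fun i : 'I_(size q) => nat_of_ord i) (P := fun i : 'I_(size q) => q`_i != 0) qi0).
move=> i qi imin.
have vterm (k : 'I_(size q)) : q`_k != 0 -> vord P (frac_emb q`_k * t ^+ k) = k%:Z.
  move=> qk; have qk0 : frac_emb q`_k != 0 by apply: frac_emb_neq0.
  by rewrite vordM ?expf_neq0 // va // vordX vt; lia.
have [||/eqP] := @vord_dom_sum _ _ _ P _ (fun i : 'I_(size q) => frac_emb q`_i * t ^+ i) i.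
- have qi0' : frac_emb q`_i != 0 by apply: frac_emb_neq0.
  by rewrite mulf_neq0 ?expf_neq0.
- move=> k ki; have [->|qk] := eqVneq q`_k 0; first by rewrite rmorph0 mul0r vge0.
  rewrite /vge !vterm //; have /= := imin k qk; rewrite -(inj_eq val_inj) /= in ki.
  by move: ki => /eqP; lia.
by [].
Qed.

Lemma frac_residue P a : vge P 0 (frac_emb a) ->
  exists c, vge P 1 (frac_emb a - const_emb L c).
Proof.
have [/place_center [b vb]|vx] := leP 0 (vord P (coord_x L)).
  exact: frac_residue_finite vb.
exact: frac_residue_infinite.
Qed.

(* Reducing an equation of z over K(x), scaled to be integral with a unit
   coefficient, shows that the residue of z is algebraic over K. *)
Lemma residue P z : vge P 0 z -> exists c, vge P 1 (z - const_emb L c).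
Proof.
move=> vz; have [q [q0 _] qz] := algebraic_relation z.
have sq : (0 < size q)%N by rewrite size_poly_gt0.
pose i1 := Ordinal (ltac:(by rewrite prednK) : ((size q).-1 < size q)%N).
have qi1 : q`_i1 != 0 by rewrite -[q`_i1]/(lead_coef q) lead_coef_eq0.
case: (@arg_minP _ _ _ i1 (fun i : 'I_(size q) => q`_i != 0)
  (fun i : 'I_(size q) => vord P (frac_emb q`_i)) qi1) => i0 qi0 i0min.
have qi0x : frac_emb q`_i0 != 0 by apply: frac_emb_neq0.
have /choice [r rP] : forall i : 'I_(size q),
    exists c, vge P 1 (frac_emb (q`_i / q`_i0) - const_emb L c).
  move=> i; apply: frac_residue; have [->|qi] := eqVneq q`_i 0.
    by rewrite mul0r rmorph0 vge0.
  have qix : frac_emb q`_i != 0 by apply: frac_emb_neq0.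
  rewrite vgeE fmorph_div ?mulf_neq0 ?(invr_neq0 qi0x) // (vord_div P qix qi0x).
  by have /= := i0min i qi; lia.
have rz : vge P 1 (\sum_(i < size q) const_emb L (r i) * z ^+ i).
  have -> : \sum_(i < size q) const_emb L (r i) * z ^+ i =
      - (\sum_(i < size q) (frac_emb (q`_i / q`_i0) - const_emb L (r i)) * z ^+ i).
    under [X in _ = - X]eq_bigr do rewrite mulrBl.
    rewrite sumrB; set s := (X in - (X - _)).
    suff -> : s = 0 by rewrite sub0r opprK.
    transitivity ((frac_emb q`_i0)^-1 * \sum_(i < size q) frac_emb q`_i * z ^+ i).
      by rewrite mulr_sumr; apply: eq_bigr => i _; rewrite fmorph_div mulrAC mulrC mulrA.
    by rewrite qz mulr0.
  rewrite vgeN; apply: vge_sum => i _; rewrite -[1]addr0 vgeM //.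
  exact: vgeX.
(* The reduced equation over [K]. Its coefficient at [i0] is the residue of 1, so [rho] is not
   zero. *)
pose rho := \poly_(i < size q) (if insub i is Some j then r j else 0).
have rho_coef (i : 'I_(size q)) : rho`_i = r i.
  by rewrite coef_poly ltn_ord (valK i : insub (i : nat) = Some i).
have rho0 : rho != 0.
  apply/eqP => rho0; have := rP i0; rewrite -rho_coef rho0 coef0 rmorph0 subr0.
  by rewrite divff // rmorph1 vgeE ?oner_eq0 // vord1.
have {rz} rz : vge P 1 (map_poly (const_emb L) rho).[z].
  rewrite (horner_coef_wide (n := size q)); last first.
    by rewrite size_map_poly size_poly.
  by under eq_bigr do rewrite coef_map rho_coef.
have [s rhoE] := closed_field_poly_normal rho.
have lr0 : lead_coef rho != 0 by rewrite lead_coef_eq0.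
move: rz; rewrite rhoE linearZ /= hornerZ rmorph_prod horner_prod => rz.
(* If no constant is congruent to [z], each linear factor of [rho] takes a unit value at [z],
   whereas [rz] says that the product has positive order. *)
apply: contrapT => nres.
have vs c : z - const_emb L c != 0 /\ vord P (z - const_emb L c) = 0.
  have : ~~ vge P 1 (z - const_emb L c) by apply/negP => h; apply: nres; exists c.
  have : vge P 0 (z - const_emb L c) by rewrite vgeB ?vge_const.
  rewrite /vge negb_or => + /andP[z0 vc]; rewrite (negPf z0) /= => vz0.
  by split=> //; apply/eqP; rewrite eq_le vz0 andbT -ltzD1 add0r ltNge.
have pE : \prod_(c <- s) (map_poly (const_emb L) ('X - c%:P)).[z] =
          \prod_(c <- s) (z - const_emb L c).
  by apply: eq_bigr => c _; rewrite map_polyXsubC hornerXsubC.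
have lrx0 : const_emb L (lead_coef rho) != 0 by rewrite fmorph_eq0.
move: rz; rewrite pE vgeE; last first.
  rewrite mulf_neq0 // prodf_seq_neq0; apply/allP => c _ /=.
  by case: (vs c).
rewrite vordM //; last first.
  by rewrite prodf_seq_neq0; apply/allP => c _ /=; case: (vs c).
rewrite vord_const // vord_prod => [|c]; last by case: (vs c).
by rewrite big1 // => c _; case: (vs c).
Qed.

End Places.

(** * The fundamental inequality *)

Section FundamentalInequality.
Variables (K : closedFieldType) (L : fieldExtType {fraction {poly K}}).
Local Notation place := (place (const_emb L)).
Local Notation frac_emb := (frac_emb L).
Local Notation x_sub b := (coord_x L - const_emb L b).

Lemma free_size_leq (T : finType) (Z : T -> L) :
    (forall c : T -> {fraction {poly K}},
       \sum_u frac_emb (c u) * Z u = 0 -> forall u, c u = 0) ->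
  (#|T| <= \dim {:L})%N.
Proof.
move=> freeZ; pose X := [tuple Z (enum_val i) | i < #|T|].
have /eqP <- : \dim <<X>> == #|T|.
  have: free X; last by rewrite /free size_tuple.
  apply/freeP => c c0 i; rewrite -[i]enum_valK; move: (enum_val i) => u.
  apply: (freeZ (fun u => c (enum_rank u))); rewrite -[RHS]c0.
  rewrite (reindex (@enum_val T predT)); last first.
    by exists enum_rank => ? _; rewrite ?enum_valK ?enum_rankK.
  apply: eq_bigr => j _; rewrite enum_valK -tnth_nth tnth_mktuple.
  by rewrite mulr_algl.
by rewrite dimvS ?subvf.
Qed.

(* With t i a uniformizer at P i and th i a unit at P i of large order at the
   other places, the t i ^ k * th i ^ M for k < e i are independent over K(x):
   in a linear combination, look at a coefficient of least order at b, with k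
   least among those. *)
Lemma sum_ramification_leq b (s : seq place) : uniq s ->
    (forall P, P \in s -> 0 < vord P (x_sub b)) ->
  \sum_(P <- s) vord P (x_sub b) <= (\dim {:L})%:Z.
Proof.
move=> us sb; pose n := size s; pose P (i : 'I_n) := tnth (in_tuple s) i.
have Ps i : P i \in s by apply: mem_tnth.
have Pinj : injective P by apply/tuple_uniqP.
pose e i := `|vord (P i) (x_sub b)|%N.
have eE i : vord (P i) (x_sub b) = (e i)%:Z by have := sb _ (Ps i); rewrite /e; lia.
have e0 i : (0 < e i)%N by have := sb _ (Ps i); rewrite eE.
have -> : \sum_(P <- s) vord P (x_sub b) = #|{: {i : 'I_n & 'I_(e i)}}|%:Z.
  rewrite card_tagged sumnE big_map big_enum /= -natz natr_sum big_tnth.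
  by apply: eq_bigr => i _; rewrite card_ord natz -eE.
have /choice [t tP] : forall i, exists t, t != 0 /\ vord (P i) t = 1.
  by move=> i; apply: vord_uniformizer.
have /choice [th thP] : forall i, exists z, [/\ z != 0, vord (P i) z = 0 &
    forall j, j != i -> 0 < vord (P j) z].
  move=> i; have /weak_approximation [z [z0 vz zs]] : P i \notin rem (P i) s.
    by rewrite mem_rem_uniq // inE eqxx.
  exists z; split=> // j ji; apply: zs.
  by rewrite mem_rem_uniq // inE (inj_eq Pinj) ji Ps.
have [E eltE] : exists E : nat, forall i, (e i <= E)%N.
  by exists (\max_i e i) => i; apply: leq_bigmax.
(* [t i] may have poles at the other places; the exponent [M] of [th i] outweighs them for all k < e
   i at once. *)
have [M MP] : exists M : nat, forall i j (k : 'I_(e i)),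
    (e j)%:Z <= k%:Z * vord (P j) (t i) + M%:Z.
  exists (\max_i \max_j (e i * `|vord (P j) (t i)| + e j))%N => i j k.
  have /= h1 := leq_bigmax (F := fun j => e i * `|vord (P j) (t i)| + e j)%N j.
  have /= h2 := leq_bigmax (F := fun i => \max_j (e i * `|vord (P j) (t i)| + e j))%N i.
  have h3 : (k * `|vord (P j) (t i)| <= e i * `|vord (P j) (t i)|)%N.
    by rewrite leq_mul2r ltnW ?orbT.
  have h4 : - (k * `|vord (P j) (t i)|)%N%:Z <= k%:Z * vord (P j) (t i).
    by move: (vord _ _) (nat_of_ord k) => v k'; nia.
  by lia.
pose T_ (i : 'I_n) := 'I_(e i).
pose Z (u : {i : 'I_n & 'I_(e i)}) := t (tag u) ^+ tagged u * th (tag u) ^+ M.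
have t0 i : t i != 0 by case: (tP i).
have th0 i : th i != 0 by case: (thP i).
have Z0 u : Z u != 0 by rewrite mulf_neq0 ?expf_neq0.
have vZ i (k : 'I_(e i)) : vord (P i) (Z (Tagged T_ k)) = k%:Z.
  rewrite [Z _]/(t i ^+ k * th i ^+ M) vordM ?expf_neq0 // !vordX.
  by have [_ ->] := tP i; have [_ -> _] := thP i; lia.
have vZ' i j (k : 'I_(e i)) : j != i -> (e j)%:Z <= vord (P j) (Z (Tagged T_ k)).
  move=> ji; rewrite [Z _]/(t i ^+ k * th i ^+ M) vordM ?expf_neq0 // !vordX.
  have [_ _ /(_ _ ji) vth] := thP i; have := MP i j k.
  have : M%:Z <= M%:Z * vord (P j) (th i) by nia.
  by lia.
rewrite lez_nat; apply: (free_size_leq (Z := Z)) => c cZ u1.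
apply: contrapT => /eqP cu1.
have /choice [w wP] : forall u : {i : 'I_n & 'I_(e i)}, exists w : int, c u != 0 ->
    forall P : place, 0 < vord P (x_sub b) -> vord P (frac_emb (c u)) = w * vord P (x_sub b).
  move=> u; have [cu0|cu] := eqVneq (c u) 0; first by exists 0.
  by have [w wE] := vord_frac L b cu; exists w.
(* Since k < e i <= E, this minimizes the pair (w, k) lexicographically. *)
case: (@arg_minP _ _ _ u1 (fun u => c u != 0)
  (fun u => w u * E%:Z + (tagged u)%:Z) cu1) => -[i0 k0] cu0 umin.
have vf i u : c u != 0 ->
    vord (P i) (frac_emb (c u) * Z u) = w u * (e i)%:Z + vord (P i) (Z u).
  by move=> cu; rewrite vordM ?Z0 ?frac_emb_neq0 // wP ?sb // eE.
have [||/eqP //] := @vord_dom_sum _ _ _ (P i0) _ (fun u => frac_emb (c u) * Z u) (Tagged T_ k0).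
  by rewrite mulf_neq0 ?Z0 ?frac_emb_neq0.
move=> [i k] ne; have [->|cu] := eqVneq (c (Tagged T_ k)) 0.
  by rewrite rmorph0 mul0r vge0.
have f0 u : c u != 0 -> frac_emb (c u) * Z u != 0.
  by move=> cu'; rewrite mulf_neq0 ?Z0 ?frac_emb_neq0.
rewrite (vgeE _ _ (f0 _ cu)). 
rewrite (vf _ _ cu) (vf _ _ cu0) vZ.
have /= := umin _ cu; have := ltn_ord k0; have := ltn_ord k.
have := eltE i0; have := eltE i.
set w1 := w (Tagged T_ k); set w0 := w (Tagged T_ k0) => eiE ei0E kE k0E le_w.
have w01 : w0 <= w1.
  rewrite leNgt; apply/negP => w10; suff : w1 * E%:Z <= (w0 - 1) * E%:Z by lia.
  by rewrite ler_wpM2r //; lia.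
have [ii0|ii0] := eqVneq i0 i; last first.
  have := vZ' i i0 k ii0; suff : w0 * (e i0)%:Z <= w1 * (e i0)%:Z by lia.
  by rewrite ler_wpM2r.
subst i0; rewrite vZ; have [ww|ww] := eqVneq w0 w1.
  suff : (k : nat) != k0 by move: le_w; rewrite ww; lia.
  by apply: contra_neq ne => /val_inj ->.
suff : (w0 + 1) * (e i)%:Z <= w1 * (e i)%:Z by lia.
by rewrite ler_wpM2r //; lia.
Qed.

End FundamentalInequality.

(** * Maximal subrings and existence of places *)

Section MaximalSubring.
Variables (F : fieldType).
Implicit Types (A B : set F) (z : F) (p q : {poly F}).

Definition subring_set A :=
  [/\ A 1, forall a b, A a -> A b -> A (a - b) & forall a b, A a -> A b -> A (a * b)].

Lemma subring_set0 A : subring_set A -> A 0.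
Proof. by case=> A1 AB _; rewrite -(subrr 1); apply: AB. Qed.

Lemma subring_setD A a b : subring_set A -> A a -> A b -> A (a + b).
Proof.
move=> sA Aa Ab; have A0 := subring_set0 sA; case: sA => _ AB _.
by rewrite -[b]opprK; apply: (AB _ _ Aa); rewrite -sub0r; apply: AB.
Qed.

Lemma subring_setX A a n : subring_set A -> A a -> A (a ^+ n).
Proof.
move=> [A1 _ AM] Aa; elim: n => [|n IHn]; first by rewrite expr0.
by rewrite exprS; apply: AM.
Qed.

Lemma subring_set_sum A (I : Type) (r : seq I) (f : I -> F) : subring_set A ->
  (forall i, A (f i)) -> A (\sum_(i <- r) f i).
Proof.
move=> sA Af; elim: r => [|i r IHr]; first by rewrite big_nil; apply: subring_set0.
by rewrite big_cons; apply: subring_setD.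
Qed.

(** Applied to B = K[x] and t = 1 / (x - b), this yields a ring that turns out to be a valuation
    ring in which x - b is not invertible, and thus a place over b. *)
Lemma maximal_subring B t : subring_set B -> ~ B t ->
  exists A, [/\ subring_set A, B `<=` A, ~ A t &
    forall C, subring_set C -> A `<=` C -> ~ C t -> C `<=` A].
Proof.
move=> sB Bt.
(* Zorn_bigcup also asks for an upper bound of the empty chain, hence set0. *)
pose good := [set A | A = set0 \/ [/\ subring_set A, B `<=` A & ~ A t]].
have [] := @Zorn_bigcup F good.
  move=> C Cgood Ctot; have [Cnil|] := pselect (forall A, C A -> A = set0).
    by left; apply/seteqP; split=> // z [A CA]; rewrite (Cnil A CA).
  move=> /existsNP[A0 /not_implyP[CA0 A0n]]; right.
  have Cg A : C A -> A !=set0 -> [/\ subring_set A, B `<=` A & ~ A t].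
    by move=> /Cgood[->[]|].
  have [sA0 BA0 _] : [/\ subring_set A0, B `<=` A0 & ~ A0 t].
    by apply: Cg => //; apply/set0P/eqP.
  have join a b : (\bigcup_(X in C) X) a -> (\bigcup_(X in C) X) b ->
      exists2 X, C X /\ subring_set X & X a /\ X b.
    move=> [X CX Xa] [Y CY Yb].
    have [sX _ _] := Cg X CX (ex_intro _ a Xa).
    have [sY _ _] := Cg Y CY (ex_intro _ b Yb).
    by have [/(_ _ Xa) Ya|/(_ _ Yb) Xb] := Ctot _ _ CX CY; [exists Y | exists X].
  split; first split=> [|a b Ua Ub|a b Ua Ub].
  - by exists A0 => //; case: sA0.
  - by have [X [CX [_ XB _]] [Xa Xb]] := join _ _ Ua Ub; exists X => //; apply: XB.
  - by have [X [CX [_ _ XM]] [Xa Xb]] := join _ _ Ua Ub; exists X => //; apply: XM.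
  - by move=> z Bz; exists A0 => //; apply: BA0.
  by move=> [X CX Xt]; have [_ _] := Cg X CX (ex_intro _ t Xt); apply.
move=> A [[A0|[sA BA At]] Amax].
  have : A `<` B.
    by rewrite A0; split=> // /(_ 1); case: sB => B1 _ _ /(_ B1).
  by move=> /Amax []; right; split.
exists A; split=> // C sC AC Ct; apply: contrapT => CA.
by apply: (Amax C); [split | right; split=> // z /BA /AC].
Qed.

Section ValuationRing.
Variables (A : set F) (t : F).
Hypotheses (sA : subring_set A) (At : A t) (t0 : t != 0) (AtV : ~ A t^-1).
Hypothesis Amax : forall C, subring_set C -> A `<=` C -> ~ C t^-1 -> C `<=` A.

Let A1 : A 1. Proof. by case: sA. Qed.
Let AB a b : A a -> A b -> A (a - b). Proof. by case: sA => _ h _; apply: h. Qed.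
Let AM a b : A a -> A b -> A (a * b). Proof. by case: sA => _ _; apply. Qed.

(** Localize [A] at the powers of u = 1 - t a. As u ^ k is 1 modulo t A, having u ^ k / t in [A]
    would put 1 / t in [A]; so the localization still avoids 1 / t and by maximality equals [A]. *)
Lemma maximal_subring_unit a : A a -> A (1 - t * a)^-1.
Proof.
move=> Aa; set u := 1 - t * a.
have Au : A u by apply/AB/AM.
have u0 : u != 0.
  apply/negP; rewrite subr_eq0 => /eqP ta1; apply: AtV.
  by rewrite -[t^-1]mulr1 ta1 mulKf.
have uX k : exists2 d, A d & u ^+ k = 1 - t * d.
  elim: k => [|k [d Ad IHk]]; first by exists 0; rewrite ?mulr0 ?subr0 //; apply: subring_set0.
  exists (d + a - t * d * a); last by rewrite exprSr IHk /u; ring.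
  by apply: AB; [apply: subring_setD | do 2 ?apply: AM].
pose C := [set z | exists2 k, A (u ^+ k * z) & True].
have sC : subring_set C.
  split=> [|y z [k Ay _] [l Az _]|y z [k Ay _] [l Az _]].
  - by exists 0%N; rewrite // mul1r.
  - exists (k + l)%N => //.
    have -> : u ^+ (k + l) * (y - z) = u ^+ l * (u ^+ k * y) - u ^+ k * (u ^+ l * z).
      by rewrite exprD; ring.
    by apply: AB; apply: AM => //; apply: subring_setX.
  - exists (k + l)%N => //.
    have -> : u ^+ (k + l) * (y * z) = (u ^+ k * y) * (u ^+ l * z).
      by rewrite exprD; ring.
    exact: AM.
apply: (Amax sC) => [z Az|[k Akt _]|].
- by exists 0%N; rewrite // mul1r.
- have [d Ad ukE] := uX k; apply: AtV.
  have -> : t^-1 = u ^+ k * t^-1 + d; last exact: subring_setD.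
  by rewrite ukE mulrBl mul1r mulrAC divff // mul1r subrK.
- by exists 1%N; rewrite // expr1 divff.
Qed.

(* The polynomial relation 1 = t p(z) says that 1/t lies in A[z]. *)
Let rep z n := exists p, [/\ (size p <= n)%N, forall i, A p`_i & t * p.[z] = 1].

Let rep_lt1 z n : rep z n -> (1 < n)%N.
Proof.
move=> [p [sp Ap tp]]; rewrite ltnNge; apply/negP => n1.
apply: AtV; have /size1_polyC pE := leq_trans sp n1.
by rewrite -[t^-1]mulr1 -tp mulKf // pE hornerC.
Qed.

(** Multiplied by the top power of z, the relation for 1 / z gives that power the coefficient 1 - t
    q_0, a unit of [A], and so expresses it through lower powers; [k <= n] keeps the exponents
    nonnegative. Substituting into the relation for z lowers its degree. *)
Let rep_reduce z n k : z != 0 -> rep z n -> rep z^-1 k -> (k <= n)%N -> rep z n.-1.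
Proof.
move=> z0 rz; have n_gt0 := ltnW (rep_lt1 rz); case: rz => p [sp Ap tp].
move=> [q [sq Aq tq]] kn; case: n n_gt0 sp kn => //= n _ sp kn; pose u := 1 - t * q`_0.
have Au : A u^-1 by apply: maximal_subring_unit.
have sqn := leq_trans sq kn.
have u0 : u != 0.
  apply/negP; rewrite subr_eq0 => /eqP tq1; apply: AtV.
  by rewrite -[t^-1]mulr1 tq1 mulKf.
have znE : z ^+ n = t * u^-1 * \sum_(i < n) q`_(n - i) * z ^+ i.
  apply: (mulfI u0); rewrite mulrA [u * (t * _)]mulrCA divff // mulr1.
  rewrite mulrBl mul1r -{1}[z ^+ n]mulr1 -tq (horner_coef_wide _ sqn).
  rewrite mulrCA mulr_sumr (reindex_inj rev_ord_inj) /=.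
  have -> : \sum_(i < n.+1) z ^+ n * (q`_(n.+1 - i.+1) * z^-1 ^+ (n.+1 - i.+1)) =
            \sum_(i < n.+1) q`_(n - i) * z ^+ i.
    apply: eq_bigr => i _; rewrite subSS mulrCA; congr (_ * _).
    have ni : (i <= n)%N by rewrite -ltnS.
    by rewrite -{1}(subnK ni) exprD exprVn mulrAC divff ?mul1r // expf_neq0.
  by rewrite big_ord_recr /= subnn mulrDr mulrA addrK.
exists (\poly_(i < n) (p`_i + p`_n * (t * u^-1 * q`_(n - i)))); split.
- exact: size_poly.
- move=> i; rewrite coef_poly; case: ifP => _; last exact: subring_set0.
  by apply: subring_setD => //; do 3 ?apply: AM.
rewrite horner_poly -tp; congr (_ * _); rewrite (horner_coef_wide _ sp) big_ord_recr /=.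
rewrite znE mulr_sumr mulr_sumr -big_split /=; apply: eq_bigr => i _.
by ring.
Qed.

(** If neither lies in [A], then by maximality 1 / t belongs to both A[z] and A[1/z]. Reducing the
    longer of the two relations by the other gives an infinite descent. *)
Lemma maximal_subring_valuation z : A z \/ A z^-1.
Proof.
have [->|z0] := eqVneq z 0; first by left; apply: subring_set0.
have adj y : ~ A y -> exists n, rep y n.
  move=> Ay; apply: contrapT => nr; apply: Ay.
  pose C := [set w | exists2 p : {poly F}, (forall i, A p`_i) & w = p.[y]].
  have sC : subring_set C.
    split=> [|a b [p Ap ->] [q Aq ->]|a b [p Ap ->] [q Aq ->]].
    - exists 1; last by rewrite hornerC.
      by move=> i; rewrite coef1; case: (i == 0)%N => //; apply: subring_set0.
    - by exists (p - q); rewrite ?hornerD ?hornerN // => i; rewrite coefB; apply: AB.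
    - exists (p * q); rewrite ?hornerM // => i.
      by rewrite coefM; apply: subring_set_sum => // j; apply: AM.
  apply: (Amax sC) => [w Aw|[p Ap tE]|].
  - exists w%:P; rewrite ?hornerC // => i; rewrite coefC.
    by case: (i == 0)%N => //; apply: subring_set0.
  - by apply: nr; exists (size p), p; split; rewrite // -tE divff.
  - exists 'X; rewrite ?hornerX // => i; rewrite coefX.
    by case: (i == 1)%N => //; apply: subring_set0.
apply: contrapT => /not_orP [/adj[n rn] /adj[k rk]].
have [N] := ubnP (n + k); elim: N => // N IHN in n k rn rk *.
have n1 := rep_lt1 rn; have k1 := rep_lt1 rk => nkN.
have [kn|/ltnW nk] := leqP k n.
  by apply: (IHN n.-1 k) => //; [apply: rep_reduce rk kn | lia].
apply: (IHN n k.-1) => //; last by lia.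
by apply: rep_reduce nk; rewrite ?invrK ?invr_neq0.
Qed.

End ValuationRing.
End MaximalSubring.

Section PlaceAbove.
Variables (K : closedFieldType) (L : fieldExtType {fraction {poly K}}) (b : K).
Local Notation place := (place (const_emb L)).
Local Notation frac_emb := (frac_emb L).
Local Notation poly_emb := (poly_emb L).
Local Notation x_sub b := (coord_x L - const_emb L b).
Let x := x_sub b.
Let x0 : x != 0. Proof. exact: coord_xB_neq0. Qed.

Section ValuationRing.
Variable A : set L.
Hypotheses (sA : subring_set A) (Apoly : forall p, A (poly_emb p)) (AxV : ~ A x^-1).
Hypothesis Amax : forall C, subring_set C -> A `<=` C -> ~ C x^-1 -> C `<=` A.

Let A0 : A 0. Proof. exact: subring_set0. Qed.
Let A1 : A 1. Proof. by case: sA. Qed.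
Let AM y z : A y -> A z -> A (y * z). Proof. by case: sA => _ _; apply. Qed.
Let Ax : A x. Proof. by rewrite /x -poly_embXsubC. Qed.
Let Avr z : A z \/ A z^-1. Proof. exact: maximal_subring_valuation Amax z. Qed.

Let unit z := [/\ z != 0, A z & A z^-1].

Let unitM y z : unit y -> unit z -> unit (y * z).
Proof.
move=> [y0 Ay AyV] [z0 Az AzV]; split; rewrite ?mulf_neq0 //; first exact: AM.
by rewrite invfM; apply: AM.
Qed.

Let unitV z : unit z -> unit z^-1.
Proof. by move=> [z0 Az AzV]; split; rewrite ?invr_eq0 ?invrK. Qed.

Let unitX z n : unit z -> unit (z ^+ n).
Proof.
move=> uz; elim: n => [|n IHn]; last by rewrite exprS; apply: unitM.
by rewrite expr0; split; rewrite ?invr1 ?oner_eq0.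
Qed.

(** Up to the constant p(b), [p] has the form 1 - (x - b) a, which [maximal_subring_unit]
    inverts. *)
Let unit_poly p : p.[b] != 0 -> unit (poly_emb p).
Proof.
move=> pb0; have p0 : p != 0 by apply: contra_neq pb0 => ->; rewrite horner0.
split=> //; first by rewrite poly_emb_eq0.
have /factor_theorem [q pE] : root (p - p.[b]%:P) b.
  by rewrite /root !hornerE subrr.
have pbV : poly_emb (p.[b])%:P != 0 by rewrite poly_emb_eq0 polyC_eq0.
pose a := poly_emb (- (p.[b])^-1 *: q).
have -> : (poly_emb p)^-1 = poly_emb (p.[b]^-1)%:P * (1 - x * a)^-1.
  have pE1 : p = p.[b]%:P * (1 - ('X - b%:P) * (- (p.[b])^-1 *: q)).
    rewrite mulrBr mulr1 -scalerAr scaleNr mulrN opprK mul_polyC scalerA divff //.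
    by rewrite scale1r mulrC -pE addrC subrK.
  rewrite {1}pE1 rmorphM invfM !poly_embC fmorphV; congr (_ * _).
  by rewrite rmorphB rmorph1 rmorphM poly_embXsubC.
apply: AM; first exact: Apoly.
by apply: (maximal_subring_unit sA Ax x0 AxV Amax); apply: Apoly.
Qed.

Let frac_unit c : c != 0 -> exists (w : int) u, unit u /\ frac_emb c = x ^ w * u.
Proof.
move=> c0; have [w [n [d [nb db ->]]]] := local_form L b c0.
by exists w, (poly_emb n / poly_emb d); split=> //; apply/unitM/unitV; apply: unit_poly.
Qed.

Let A_expx_ge0 (k : int) : A (x ^ k) -> 0 <= k.
Proof.
case: k => // k Axk; case: AxV; move: Axk; rewrite NegzE -exprnN => Axk.
have -> : x^-1 = x ^+ k * x ^- k.+1 by rewrite exprSr invfM mulrA divff ?mul1r // expf_neq0.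
by apply: AM => //; apply: subring_setX.
Qed.

(** Divisibility in a valuation ring is a total preorder, so a term of least order can be chosen
    before any integer valuation exists. *)
Let dominant (I : finType) (P : pred I) (f : I -> L) i0 : P i0 ->
    (forall i, P i -> f i != 0) ->
  exists2 i, P i & forall j, P j -> A (f j / f i).
Proof.
move=> Pi0 f0; pose ord y z := `[< A (z / y) >].
have [|||//|i Pi imin] := @extremum_inP _ I ord i0 P f.
- by move=> i /f0 fi; apply/asboolP; rewrite divff.
- move=> j i k /f0 fj /f0 fi /f0 fk /asboolP ij /asboolP jk; apply/asboolP.
  have -> : f k / f i = (f k / f j) * (f j / f i) by rewrite mulrA divfK.
  exact: AM.
- move=> i j /f0 fi /f0 fj; apply/orP; have [Aij|] := Avr (f j / f i).
    by left; apply/asboolP.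
  by rewrite invf_div => Aji; right; apply/asboolP.
by exists i => // j Pj; apply/asboolP/imin.
Qed.

(** Here [x] stands for x - b. In an equation of z over K(x), a term [T i0] of least order and a
    term [T i1] of least order among the others differ by a unit, because the sum vanishes. Their
    coefficients differ by a power of [x] up to a unit, so the same holds for z ^ i0 and z ^ i1. *)
Let unit_power z : z != 0 -> exists j (k : int),
  (0 < j <= \dim {:L})%N /\ unit (z ^+ j * x ^ k).
Proof.
move=> z0; have [q [q0 sq] qz] := algebraic_relation z.
have q1 : (0 < size q)%N by rewrite size_poly_gt0.
pose i2 := Ordinal (ltac:(by rewrite prednK) : ((size q).-1 < size q)%N).
have qi2 : q`_i2 != 0 by rewrite -[q`_i2]/(lead_coef q) lead_coef_eq0.
pose T (i : 'I_(size q)) := frac_emb q`_i * z ^+ i.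
have T0 (i : 'I_(size q)) : q`_i != 0 -> T i != 0.
  by move=> qi; rewrite mulf_neq0 ?expf_neq0 ?frac_emb_neq0.
have [i0 /= qi0 domi0] := dominant (P := fun i : 'I_(size q) => q`_i != 0) qi2 T0.
have [i3 qi3 i30] : exists2 i3 : 'I_(size q), q`_i3 != 0 & i3 != i0.
  apply: contrapT => n3; have /eqP := T0 _ qi0; apply.
  rewrite -[RHS]qz (bigD1 i0) //= big1 ?addr0 // => i ii0.
  have [->|qi] := eqVneq q`_i 0; first by rewrite rmorph0 mul0r.
  by case: n3; exists i.
have [i1 /andP[qi1 i10] domi1] := dominant (I := 'I_(size q))
  (P := fun i => (q`_i != 0) && (i != i0)) (introT andP (conj qi3 i30))
  (fun i (Pi : (q`_i != 0) && (i != i0)) => T0 i (proj1 (andP Pi))).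
have uT : unit (T i0 / T i1).
  split; first exact: mulf_neq0 (T0 _ qi0) (invr_neq0 (T0 _ qi1)).
    have -> : T i0 = - \sum_(i | i != i0) T i.
      by apply/eqP; rewrite -addr_eq0; have /eqP := qz; rewrite (bigD1 i0).
    rewrite mulNr mulr_suml -sub0r; case: sA => _ AB _; apply: AB => //.
    apply: big_ind => // [y w Ay Aw|i ii0]; first exact: subring_setD.
    have [qi|qi] := eqVneq q`_i 0; first by rewrite /T qi rmorph0 !mul0r.
    by apply: domi1; rewrite qi.
  by rewrite invf_div; apply: domi0.
have q10 : q`_i0 / q`_i1 != 0 := mulf_neq0 qi0 (invr_neq0 qi1).
have [w [u [uu qE]]] := frac_unit q10.
have TE : T i0 / T i1 = x ^ w * u * (z ^+ i0 / z ^+ i1).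
  by rewrite -qE fmorph_div /T invfM mulrACA.
have uz : unit (z ^+ i0 / z ^+ i1 * x ^ w).
  have -> : z ^+ i0 / z ^+ i1 * x ^ w = T i0 / T i1 / u.
    by case: uu => u0 _ _; rewrite TE [RHS]mulrAC mulfK // mulrC.
  exact/unitM/unitV.
have lt0 := ltn_ord i0; have lt1 := ltn_ord i1.
have [i01|i01|/val_inj i01] := ltngtP i0 i1; last by rewrite i01 eqxx in i10.
- exists (i1 - i0)%N, (- w); split.
    by rewrite subn_gt0 i01 (leq_trans (leq_subr _ _)) // -ltnS (leq_trans lt1).
  have -> : z ^+ (i1 - i0) * x ^ (- w) = (z ^+ i0 / z ^+ i1 * x ^ w)^-1.
    rewrite !invfM invrK invr_expz; congr (_ * _).
    by rewrite -{2}(subnK (ltnW i01)) exprD mulrCA mulVf ?mulr1 // expf_neq0.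
  exact: unitV.
- exists (i0 - i1)%N, w; split.
    by rewrite subn_gt0 i01 (leq_trans (leq_subr _ _)) // -ltnS (leq_trans lt0).
  suff -> : z ^+ (i0 - i1) = z ^+ i0 / z ^+ i1 by [].
  by rewrite -{2}(subnK (ltnW i01)) exprD mulfK // expf_neq0.
Qed.

(* Every value group element has an m'-th multiple in Z v(x) for some
   m' <= [L : K(x)]; the factorial gives a common exponent, so that z ^ N = x ^ v(z)
   up to a unit defines an integer valuation v, normalized at the end. *)
Let N := (\dim {:L})`!.

Let unit_fact z : exists k : int, z != 0 -> unit (z ^+ N * x ^ (- k)).
Proof.
have [->|z0] := eqVneq z 0; first by exists 0.
have [j [k [j1 uz]]] := unit_power z0; exists (- k * (N %/ j)%N%:Z) => _.
have jN : (j %| N)%N by apply: dvdn_fact.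
have := unitX (N %/ j) uz; rewrite exprMn -exprM mulnC divnK //.
by rewrite (exprnP (x ^ k)) exprz_exp mulNr opprK.
Qed.

Lemma valuation_ring_place : exists P : place, 0 < vord P x.
Proof.
have /choice [v vP] := unit_fact.
have vE z (k : int) : z != 0 -> unit (z ^+ N * x ^ (- k)) -> v z = k.
  move=> z0 uk; have uv := vP z z0.
  have ukv : unit (x ^ (v z - k)).
    have -> : x ^ (v z - k) = z ^+ N * x ^ (- k) / (z ^+ N * x ^ (- v z)).
      rewrite invfM mulrACA divff ?expf_neq0 // mul1r invr_expz opprK.
      by rewrite addrC expfzDr.
    exact/unitM/unitV.
  have [_ /A_expx_ge0 h1] := ukv; rewrite invr_expz => /A_expx_ge0; lia.
have vM y z : y != 0 -> z != 0 -> v (y * z) = v y + v z.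
  move=> y0 z0; apply: vE; first by rewrite mulf_neq0.
  have -> : (y * z) ^+ N * x ^ (- (v y + v z)) =
      (y ^+ N * x ^ (- v y)) * (z ^+ N * x ^ (- v z)).
    by rewrite opprD expfzDr // exprMn mulrACA.
  by apply: unitM; apply: vP.
have unit1 : unit 1 by split; rewrite ?invr1 ?oner_eq0.
have v1 : v 1 = 0 by apply: vE; rewrite ?oner_eq0 // oppr0 expr0z expr1n mulr1.
have N0 : (0 < N)%N by apply: fact_gt0.
have v_ge0 z : z != 0 -> A z -> 0 <= v z.
  move=> z0 Az; have [_ _ ] := vP z z0; rewrite invfM invr_expz opprK => AVz.
  apply: A_expx_ge0; rewrite -[_ ^ _](mulVKf (expf_neq0 N z0)).
  by apply: AM => //; apply: subring_setX.
have A_ge0 z : z != 0 -> 0 <= v z -> A z.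
  move=> z0 vz; have [//|AzV] := Avr z.
  have [_ AzN _] := vP z z0; have {AzN} AzN : A (z ^+ N).
    have -> : z ^+ N = (z ^+ N * x ^ (- v z)) * x ^ (v z).
      by rewrite -mulrA -expfzDr // addNr mulr1.
    apply: AM => //; case: (v z) vz => // n _.
    by rewrite -exprnP; apply: subring_setX.
  have -> : z = z ^+ N * z^-1 ^+ N.-1.
    by rewrite -{1}(prednK N0) exprS exprVn mulfK // expf_neq0.
  by apply: AM => //; apply: subring_setX.
have vx : v x = N%:Z.
  by apply: vE => //; rewrite -exprnN divff // expf_neq0.
have vD y z : y != 0 -> z != 0 -> y + z != 0 -> Num.min (v y) (v z) <= v (y + z).
  have wl y' z' : y' != 0 -> z' != 0 -> y' + z' != 0 -> v y' <= v z' -> v y' <= v (y' + z').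
    move=> y0 z0 yz0 yz; have vq : v z' = v y' + v (z' / y').
      by rewrite -vM ?mulf_neq0 ?invr_neq0 // mulrCA divff ?mulr1.
    have zy0 : z' / y' != 0 by rewrite mulf_neq0 ?invr_neq0.
    have yzE : y' + z' = y' * (1 + z' / y') by rewrite mulrDr mulr1 mulrCA divff ?mulr1.
    have u0 : 1 + z' / y' != 0 by move: yz0; rewrite yzE mulf_eq0 negb_or => /andP[].
    rewrite yzE vM // lerDl; apply: v_ge0 => //; apply: subring_setD => //.
    by apply: A_ge0 => //; lia.
  move=> y0 z0 yz0; have [yz|/ltW zy] := leP (v y) (v z); first exact: wl.
  by rewrite addrC; apply: wl; rewrite // addrC.
have vV z : z != 0 -> v z^-1 = - v z.
  by move=> z0; have := vM _ _ z0 (invr_neq0 z0); rewrite divff // v1; lia.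
have vX z n : z != 0 -> v (z ^+ n) = n%:Z * v z.
  move=> z0; elim: n => [|n IHn]; first by rewrite expr0 v1 mul0r.
  by rewrite exprS vM ?expf_neq0 // IHn; lia.
(* The values of [v] form a subgroup of the integers, nonzero because v x = N. Dividing by its
   positive generator [e] makes the valuation surjective. *)
have exv : exists n : nat, [&& (0 < n)%N & `[< exists2 z, z != 0 & v z = n%:Z >]].
  by exists N; rewrite N0; apply/asboolP; exists x.
case: (ex_minnP exv) => e /andP[e0 /asboolP[t t0 vt]] emin.
have edvd z : z != 0 -> (e %| v z)%Z.
  move=> z0; have e_neq0 : e%:Z != 0 by lia.
  have r0 := modz_ge0 (v z) e_neq0; have re : (v z %% e)%Z < e by rewrite ltz_pmod.
  have vr : exists2 y, y != 0 & v y = (v z %% e)%Z.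
    have vdiv := divz_eq (v z) e; case: (v z %/ e)%Z vdiv => n vdiv.
      exists (z / t ^+ n); first exact: mulf_neq0 z0 (invr_neq0 (expf_neq0 n t0)).
      by rewrite vM ?(invr_neq0 (expf_neq0 n t0)) // vV ?expf_neq0 // vX // vt; lia.
    exists (z * t ^+ n.+1); first exact: mulf_neq0 z0 (expf_neq0 _ t0).
    by rewrite vM ?expf_neq0 // vX // vt; lia.
  apply/dvdz_mod0P; case: (v z %% e)%Z r0 re vr => // -[//|n] _ ne vr.
  by have := emin n.+1; rewrite /= => /(_ (introT (asboolP _) vr)); lia.
pose w z := if z == 0 then 0 else (v z %/ e)%Z.
have wE z : z != 0 -> w z * e%:Z = v z.
  by move=> z0; rewrite /w (negPf z0) divzK // edvd.
have w0 : w 0 = 0 by rewrite /w eqxx.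
have wM y z : y != 0 -> z != 0 -> w (y * z) = w y + w z.
  move=> y0 z0; have := wE _ (mulf_neq0 y0 z0); rewrite vM // -!wE // -mulrDl.
  by apply: mulIf; lia.
have wD y z : y != 0 -> z != 0 -> y + z != 0 -> Num.min (w y) (w z) <= w (y + z).
  move=> y0 z0 yz0; have := vD y z y0 z0 yz0; rewrite -!wE //; nia.
have wc c : c != 0 -> w (const_emb L c) = 0.
  move=> c0; have cx0 : const_emb L c != 0 by rewrite fmorph_eq0.
  have c_ge0 a : a != 0 -> 0 <= v (const_emb L a).
    by move=> a0; apply: v_ge0; rewrite ?fmorph_eq0 // -poly_embC.
  have := vV _ cx0; rewrite -fmorphV => vcV; have := c_ge0 _ c0.
  by have := c_ge0 _ (invr_neq0 c0); rewrite vcV; have := wE _ cx0; nia.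
have wt : exists t, t != 0 /\ w t = 1.
  by exists t; split=> //; have := wE _ t0; rewrite vt; nia.
by exists (Place w0 wM wD wc wt); rewrite /=; have := wE _ x0; rewrite vx; nia.
Qed.

End ValuationRing.

Lemma place_above : exists P : place, 0 < vord P (x_sub b).
Proof.
have sB : subring_set (range poly_emb).
  split=> [|_ _ [p _ <-] [q _ <-]|_ _ [p _ <-] [q _ <-]].
  - by exists 1; rewrite ?rmorph1.
  - by exists (p - q); rewrite ?rmorphB.
  - by exists (p * q); rewrite ?rmorphM.
have BxV : ~ range poly_emb x^-1.
  move=> [p _ px]; have : poly_emb (p * ('X - b%:P)) == poly_emb 1.
    by rewrite rmorphM poly_embXsubC px mulVf // rmorph1.
  rewrite -subr_eq0 -rmorphB poly_emb_eq0 subr_eq0 => /eqP /(congr1 (horner^~ b)).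
  by rewrite hornerM !hornerE subrr mulr0 => /eqP; rewrite eq_sym oner_eq0.
have [A [sA BA AxV Amax]] := maximal_subring sB BxV.
by apply: (valuation_ring_place sA _ AxV Amax) => p; apply: BA; exists p.
Qed.

End PlaceAbove.

(** * Kummer extensions *)

Section Kummer.
Variables (K : closedFieldType) (L : fieldExtType {fraction {poly K}}).
Variables (m r : nat) (alpha : 'I_r -> K) (lambda : 'I_r -> nat) (y : L).
Local Notation place := (place (const_emb L)).
Local Notation frac_emb := (frac_emb L).
Local Notation poly_emb := (poly_emb L).
Local Notation x_sub b := (coord_x L - const_emb L b).
Local Notation lambda0 := (\sum_(i < r) lambda i)%N.

Hypothesis m_gt0 : (0 < m)%N.
Hypothesis coprime_m : coprime m lambda0.
Hypothesis yE : y ^+ m = \prod_(i < r) x_sub (alpha i) ^+ lambda i.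
Hypothesis genL : <<1; y>>%VS = fullv.

Lemma y_neq0 : y != 0.
Proof.
have : y ^+ m != 0.
  by rewrite yE; apply/prodf_neq0 => i _; rewrite expf_neq0 ?coord_xB_neq0.
by rewrite expf_eq0 m_gt0.
Qed.

Lemma term_neq0 c b : c != 0 -> frac_emb c * y ^+ b != 0.
Proof. by move=> c0; apply: mulf_neq0; [apply: frac_emb_neq0 | apply/expf_neq0/y_neq0]. Qed.

Lemma vord_term (P : place) c b : c != 0 ->
  vord P (frac_emb c * y ^+ b) = vord P (frac_emb c) + b%:Z * vord P y.
Proof.
by move=> c0; rewrite vordM ?vordX //; [apply: frac_emb_neq0 | apply/expf_neq0/y_neq0].
Qed.

Lemma vord_y (P : place) :
  m%:Z * vord P y = \sum_(i < r) (lambda i)%:Z * vord P (x_sub (alpha i)).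
Proof.
rewrite -vordX yE vord_prod => [|i]; last by rewrite expf_neq0 ?coord_xB_neq0.
by apply: eq_bigr => i _; rewrite vordX.
Qed.

Lemma minPoly_y_dvd :
  minPoly 1 y %| 'X^m - (\prod_(i < r) x_sub (alpha i) ^+ lambda i)%:P.
Proof.
apply: minPoly_dvdp; last by rewrite /root !hornerE yE subrr.
rewrite rpredB ?rpredX ?polyOverX ?polyOverC //.
apply: rpred_prod => i _; apply: rpredX; rewrite -poly_embXsubC.
by apply/vlineP; exists (FracField.tofrac ('X - (alpha i)%:P)).
Qed.

Lemma adjoin_degree_y_leq : (adjoin_degree 1 y <= m)%N.
Proof.
have := dvdp_leq _ minPoly_y_dvd; rewrite size_minPoly size_XnsubC // ltnS.
by apply; rewrite -size_poly_eq0 size_XnsubC.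
Qed.

Lemma dim_leq : (\dim {:L} <= m)%N.
Proof. by rewrite -genL dim_Fadjoin dimv1 muln1 adjoin_degree_y_leq. Qed.

Lemma kummer_decomposition z :
  exists c : 'I_m -> {fraction {poly K}}, z = \sum_(b < m) frac_emb (c b) * y ^+ b.
Proof.
have zy : z \in <<1; y>>%VS by rewrite genL memvf.
have /polyOver1P [p pE] := Fadjoin_polyOver 1 y z.
exists (fun b => p`_b); rewrite -{1}(Fadjoin_poly_eq zy) (horner_coef_wide (n := m)).
  by apply: eq_bigr => b _; rewrite pE coef_map.
by rewrite (leq_trans (size_Fadjoin_poly _ _ _)) // adjoin_degree_y_leq.
Qed.

Section InfinitePlace.
Variable P : place.
Hypothesis vx_lt0 : vord P (coord_x L) < 0.

Lemma vord_xB_infinite b : vord P (x_sub b) = vord P (coord_x L).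
Proof.
by rewrite -poly_embXsubC vord_poly_infinite ?polyXsubC_eq0 // size_XsubC mul1r.
Qed.

Lemma vord_frac_infinite c : c != 0 ->
  exists n : int, forall P' : place, vord P' (coord_x L) < 0 ->
    vord P' (frac_emb c) = n * vord P' (coord_x L).
Proof.
move=> c0; have [n [d [d0 cE]]] := fracP L c; have := frac_emb_neq0 L c0.
rewrite cE mulf_eq0 negb_or => /andP[nx0 _].
have dx0 : poly_emb d != 0 by rewrite poly_emb_eq0.
exists ((size n).-1%:Z - (size d).-1%:Z) => P' vP'.
have n0 : n != 0 by rewrite poly_emb_eq0 in nx0.
rewrite (vord_div _ nx0 dx0) (vord_poly_infinite vP' n0) (vord_poly_infinite vP' d0).
by rewrite mulrBl.
Qed.

Lemma vord_infinite_scale : exists2 k : int, 0 < k &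
  vord P (coord_x L) = - m%:Z * k /\ vord P y = - lambda0%:Z * k.
Proof.
have := vord_y P; under eq_bigr do rewrite vord_xB_infinite.
have l0E : \sum_(i < r) (lambda i)%:Z = lambda0%:Z.
  by rewrite -natz natr_sum; apply: eq_bigr => i _; rewrite natz.
rewrite -mulr_suml l0E => vy.
have /dvdzP [k kE] : (m %| vord P (coord_x L))%Z.
  rewrite -(@Gauss_dvdzr _ lambda0%:Z) //.
  by rewrite -vy dvdz_mulr.
exists (- k); first by nia.
split; first by rewrite kE; ring.
by apply: (@mulfI _ m%:Z); [lia | rewrite vy kE; ring].
Qed.

(** Divided by the scale k, the order of the b-th term is -b lambda0 modulo m. By coprimality these
    residues differ for distinct b < m, so two nonzero terms never have the same order. *)
Lemma dominant_term (c : 'I_m -> {fraction {poly K}}) : (exists b, c b != 0) ->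
  exists2 b, c b != 0 & forall b', b' != b ->
    vge P (vord P (frac_emb (c b) * y ^+ b) + 1) (frac_emb (c b') * y ^+ b').
Proof.
move=> [b0 cb0]; case: (@arg_minP _ _ _ b0 (fun b => c b != 0)
  (fun b => vord P (frac_emb (c b) * y ^+ b)) cb0) => b cb bmin.
exists b => // b' b'b; have [->|cb'] := eqVneq (c b') 0.
  by rewrite rmorph0 mul0r vge0.
rewrite (vgeE _ _ (term_neq0 _ cb')) lezD1 lt_neqAle bmin // andbT.
have [k k0 [vx vy]] := vord_infinite_scale.
have [n nE] := vord_frac_infinite cb; have [n' n'E] := vord_frac_infinite cb'.
rewrite (vord_term P b cb) (vord_term P b' cb') nE // n'E // vx vy.
apply: contra b'b => /eqP eqv.
have : (m %| lambda0%:Z * (b'%:Z - b%:Z))%Z.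
  apply/dvdzP; exists (n - n'); apply: (@mulIf _ k); first by rewrite gt_eqF.
  by move: eqv; lia.
rewrite Gauss_dvdzr // => /dvdzP [d dE].
rewrite -(inj_eq val_inj) /=; have := ltn_ord b; have := ltn_ord b'.
move=> b'm bm; have d0 : d = 0.
  by have [d_lt0|d_gt0|//] := ltgtP d 0; nia.
by rewrite d0 mul0r in dE; apply/eqP; lia.
Qed.

Lemma vord_sum_dominant (c : 'I_m -> {fraction {poly K}}) : (exists b, c b != 0) ->
  exists2 b, c b != 0 & \sum_(b < m) frac_emb (c b) * y ^+ b != 0 /\
    vord P (\sum_(b < m) frac_emb (c b) * y ^+ b) = vord P (frac_emb (c b) * y ^+ b).
Proof.
move=> /dominant_term [b cb bdom]; exists b => //.
by apply: (@vord_dom_sum _ _ _ P _ (fun b : 'I_m => _)) => //; apply: term_neq0.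
Qed.

Lemma vord_decomposition (z : L) : z != 0 -> exists2 c : 'I_m -> {fraction {poly K}},
    z = \sum_(b < m) frac_emb (c b) * y ^+ b &
  exists2 b, c b != 0 & vord P z = vord P (frac_emb (c b) * y ^+ b).
Proof.
move=> z0; have [c zE] := kummer_decomposition z; exists c => //.
have [|b cb [_ vz]] := @vord_sum_dominant c; last by exists b; rewrite // zE.
apply: contrapT => c0; move: z0; rewrite zE big1 ?eqxx // => b _.
have [->|cb] := eqVneq (c b) 0; first by rewrite rmorph0 mul0r.
by case: c0; exists b.
Qed.

(* All values of vord P are multiples of the scale k, so a uniformizer forces
   k = 1; in particular P is totally ramified over K(x). *)
Lemma vord_xy_infinite : vord P (coord_x L) = - m%:Z /\ vord P y = - lambda0%:Z.
Proof.
have [k k0 [vx vy]] := vord_infinite_scale.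
suff k1 : k = 1 by rewrite vx vy k1 !mulr1.
have [t [t0 vt]] := vord_uniformizer P.
have [c _ [b cb]] := vord_decomposition t0.
have [n nE] := vord_frac_infinite cb.
rewrite vt (vord_term P b cb) nE // vx vy => e.
have : k * (- n * m%:Z - b%:Z * lambda0%:Z) = 1 by rewrite e; ring.
move: (_ - _) => d kd; have d0 : 0 < d by rewrite -(pmulr_rgt0 _ k0) kd.
by nia.
Qed.

End InfinitePlace.

(** The order of a function is the least order of its terms, and the order of a term is given by the
    same formula at [P] and at [P']. *)
Lemma infinite_place_unique (P P' : place) :
  vord P (coord_x L) < 0 -> vord P' (coord_x L) < 0 -> P = P'.
Proof.
move=> vx v'x; apply: place_inj => z.
have [->|z0] := eqVneq z 0; first by rewrite !vord0.
have [c zE] := kummer_decomposition z.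
have [|b cb bdom] := @dominant_term P vx c.
  apply: contrapT => c0; move: z0; rewrite zE big1 ?eqxx // => b _.
  have [->|cb] := eqVneq (c b) 0; first by rewrite rmorph0 mul0r.
  by case: c0; exists b.
have same k : c k != 0 ->
    vord P (frac_emb (c k) * y ^+ k) = vord P' (frac_emb (c k) * y ^+ k).
  move=> ck; have [n nE] := vord_frac_infinite ck.
  rewrite (vord_term P k ck) (vord_term P' k ck) !nE //.
  by have [-> ->] := vord_xy_infinite vx; have [-> ->] := vord_xy_infinite v'x.
rewrite zE.
have [||_ ->] // := @vord_dom_sum _ _ _ P _ (fun b : 'I_m => frac_emb (c b) * y ^+ b) b.
  exact: term_neq0.
have [||_ ->] // := @vord_dom_sum _ _ _ P' _ (fun b : 'I_m => frac_emb (c b) * y ^+ b) b.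
- exact: term_neq0.
- move=> k kb; have := bdom k kb; rewrite /vge; case: eqP => //= /eqP ck.
  have ck0 : c k != 0 by apply: contra_neq ck => ->; rewrite rmorph0 mul0r.
  by rewrite !same.
exact: same.
Qed.

Variable Qinf : place.
Hypothesis Qinf_lt0 : vord Qinf (coord_x L) < 0.

Lemma neq_QinfE (P : place) : (P != Qinf) = (0 <= vord P (coord_x L)).
Proof.
rewrite leNgt; congr (~~ _); apply/eqP/idP => [-> //|vx].
exact: infinite_place_unique.
Qed.

Lemma kummer_free (c : 'I_m -> {fraction {poly K}}) :
  \sum_(b < m) frac_emb (c b) * y ^+ b = 0 -> forall b, c b = 0.
Proof.
move=> c0 b; apply: contrapT => /eqP cb.
have [|b' _ [/eqP]] := @vord_sum_dominant Qinf Qinf_lt0 c; last by rewrite c0.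
by exists b.
Qed.

(** The equation bounds the degree of y by m; the independence of 1, ..., y^(m-1), read off at
    [Qinf], shows that the bound is attained. *)
Lemma minPoly_y : minPoly 1 y = 'X^m - (y ^+ m)%:P.
Proof.
have /= m_le := free_size_leq kummer_free.
have dL : \dim {:L} = adjoin_degree 1 y by rewrite -genL dim_Fadjoin dimv1 muln1.
apply/eqP; rewrite -eqp_monic ?monic_minPoly ?monicXnsubC // yE.
rewrite -dvdp_size_eqp ?minPoly_y_dvd // size_minPoly size_XnsubC // eqSS.
by rewrite eqn_leq adjoin_degree_y_leq -dL (leq_trans _ m_le) // card_ord.
Qed.

Lemma twist w : w ^+ m = 1 -> exists s : {rmorphism L -> L},
  (forall a, s (frac_emb a) = frac_emb a) /\ s y = const_emb L w * y.
Proof.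
move=> wm; pose s := kHomExtend 1%AS \1%VF y (const_emb L w * y).
have hom1 : kHom 1 1 (\1%VF : 'End(L)) by apply: kHom1.
have rootwy : root (map_poly (\1%VF : 'End(L)) (minPoly 1%AS y)) (const_emb L w * y).
  rewrite lfun1_poly minPoly_y /root !hornerE exprMn -rmorphXn wm rmorph1 mul1r.
  by rewrite subrr.
have sP : kHom 1 <<1%AS; y>> s by apply: kHomExtendP.
have [s_id sM] := kHomP_tmp sP.
have s_monoid : monoid_morphism s.
  split; first by rewrite s_id ?mem1v.
  by move=> a b; apply: sM; rewrite genL memvf.
pose sMM := GRing.isMonoidMorphism.Build _ _ _ s_monoid.
pose sR : {rmorphism L -> L} := HB.pack (fun_of_lfun s) sMM.
exists sR; split=> [a|].
  by rewrite -[LHS]/(s _) s_id // memvZ ?mem1v.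
by rewrite -[LHS]/(s _) (kHomExtend_val hom1).
Qed.

(** Regularity away from Q_infty: by [neq_QinfE], the places where x has no pole are exactly those
    different from [Qinf]. *)
Definition regular z := forall P : place, 0 <= vord P (coord_x L) -> vge P 0 z.

Lemma regular_twist (c : 'I_m -> {fraction {poly K}}) w : w ^+ m = 1 ->
    regular (\sum_(b < m) frac_emb (c b) * y ^+ b) ->
  regular (\sum_(b < m) frac_emb (c b) * (const_emb L w * y) ^+ b).
Proof.
move=> wm; have w0 : w != 0.
  by apply: contra_eq_neq wm => ->; rewrite expr0n gtn_eqF // eq_sym oner_eq0.
have [s [s_frac sy]] := twist wm.
have s_sum (u : K) (d : 'I_m -> {fraction {poly K}}) :
    s (\sum_(b < m) frac_emb (d b) * (const_emb L u * y) ^+ b) =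
    \sum_(b < m) frac_emb (d b) * (const_emb L (u * w) * y) ^+ b.
  rewrite rmorph_sum; apply: eq_bigr => b _.
  transitivity (s (frac_emb (d b)) * (s (const_emb L u) * s y) ^+ b).
    by rewrite -rmorphM -rmorphXn -rmorphM.
  by rewrite s_frac [s (const_emb L u)]s_frac sy rmorphM mulrA.
have s0 z : (s z == 0) = (z == 0) by apply: fmorph_eq0.
move=> regz P vx.
(* The pullback of [P] along [s] is again a place, and a finite one because [s] fixes x. *)
pose v z := vord P (s z).
have v0 : v 0 = 0 by rewrite /v rmorph0 vord0.
have vM a b : a != 0 -> b != 0 -> v (a * b) = v a + v b.
  by move=> a0 b0; rewrite /v rmorphM vordM ?s0.
have vD a b : a != 0 -> b != 0 -> a + b != 0 -> Num.min (v a) (v b) <= v (a + b).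
  by move=> a0 b0; rewrite -s0 /v rmorphD; apply: vordD; rewrite s0.
have vc k : k != 0 -> v (const_emb L k) = 0.
  by move=> k0; rewrite /v [s _]s_frac; apply: vord_const.
(* A uniformizer of the pullback is a preimage under [s] of one at [P], obtained by twisting its
   components by the inverse root of unity. *)
have vt : exists t, t != 0 /\ v t = 1.
  have [t [t0 vt]] := vord_uniformizer P; have [d tE] := kummer_decomposition t.
  have tE' : t = s (\sum_(b < m) frac_emb (d b) * (const_emb L w^-1 * y) ^+ b).
    rewrite s_sum mulVf // tE; apply: eq_bigr => b _.
    by rewrite rmorph1 mul1r.
  by exists (\sum_(b < m) frac_emb (d b) * (const_emb L w^-1 * y) ^+ b); rewrite -s0 /v -tE'.
pose P' := Place v0 vM vD vc vt.
have : vge P' 0 (\sum_(b < m) frac_emb (c b) * y ^+ b).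
  by apply: regz; rewrite /= /v [s _]s_frac.
rewrite /vge /= /v -s0.
suff -> : s (\sum_(b < m) frac_emb (c b) * y ^+ b) =
  \sum_(b < m) frac_emb (c b) * (const_emb L w * y) ^+ b by [].
rewrite -[w]mul1r -s_sum; congr (s _); apply: eq_bigr => b _.
by rewrite rmorph1 mul1r.
Qed.

Hypothesis m_unit : m%:R != 0 :> K.

Lemma exists_primitive_root : exists z : K, m.-primitive_root z.
Proof.
have [s sE] := closed_field_poly_normal ('X^m - 1 : {poly K}).
have lc : lead_coef ('X^m - 1 : {poly K}) = 1 by rewrite lead_coefXnsubC.
rewrite lc scale1r in sE.
have /hasP [z _ zm] : has m.-primitive_root s; last by exists z.
apply: has_prim_root => //.
- by apply/allP => z zs; rewrite /root_of_unity sE root_prod_XsubC.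
- by rewrite -separable_prod_XsubC -sE separable_Xn_sub_1.
have := size_XnsubC (1 : K) m_gt0; rewrite sE size_prod_XsubC => -[->].
exact: leqnn.
Qed.

(* Averaging the twists y -> zeta y against a character of the group of m-th
   roots of unity isolates one component. *)
Lemma regular_component (c : 'I_m -> {fraction {poly K}}) b0 :
    regular (\sum_(b < m) frac_emb (c b) * y ^+ b) ->
  regular (frac_emb (c b0) * y ^+ b0).
Proof.
move=> regz P vx; have [zt ztP] := exists_primitive_root.
have mx0 : const_emb L m%:R != 0 by rewrite fmorph_eq0.
suff : vge P 0 (const_emb L m%:R * (frac_emb (c b0) * y ^+ b0)).
  move=> vm; rewrite -[X in vge _ _ X](mulKf mx0) -[0]addr0 vgeM // -fmorphV.
  exact: vge_const.
pose T k := \sum_(b < m) frac_emb (c b) * (const_emb L (zt ^+ k) * y) ^+ b.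
have TE (k : nat) (b : 'I_m) : const_emb L (zt ^+ (k * (m - b0))) *
      (frac_emb (c b) * (const_emb L (zt ^+ k) * y) ^+ b) =
    const_emb L ((zt ^+ (b + (m - b0))) ^+ k) * (frac_emb (c b) * y ^+ b).
  rewrite exprMn -rmorphXn -!exprM mulnDl exprD rmorphM [(k * b)%N]mulnC.
  by rewrite [(k * _)%N]mulnC; ring.
(* The weight zt ^ (k (m - b0)) is zt ^ (-k b0) with a natural exponent. For b different from b0,
   the number b + (m - b0) lies strictly between 0 and 2 m and is not m, so the geometric sum
   vanishes. *)
have -> : const_emb L m%:R * (frac_emb (c b0) * y ^+ b0) =
    \sum_(k < m) const_emb L (zt ^+ (k * (m - b0))) * T k.
  under [RHS]eq_bigr do rewrite mulr_sumr.
  rewrite exchange_big (bigD1 b0) //= [X in _ + X]big1 ?addr0.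
    rewrite rmorph_nat -{1}(card_ord m) -sumr_const mulr_suml; apply: eq_bigr => k _.
    rewrite TE subnKC ?(ltnW (ltn_ord _)) // (prim_expr_order ztP) expr1n rmorph1.
    by rewrite !mul1r.
  move=> b bb0.
  transitivity ((\sum_(k < m) const_emb L ((zt ^+ (b + (m - b0))) ^+ k)) *
      (frac_emb (c b) * y ^+ b)).
    by rewrite mulr_suml; apply: eq_bigr => k _; rewrite TE.
  rewrite -rmorph_sum; set e := zt ^+ _.
  suff -> : \sum_(k < m) e ^+ k = 0 by rewrite rmorph0 mul0r.
  have e1 : e - 1 != 0.
    rewrite subr_eq0 -(prim_order_dvd ztP); apply: contra bb0 => dv.
    rewrite -(inj_eq val_inj) /=; apply/eqP.
    have := ltn_ord b; have := ltn_ord b0; move: dv => /dvdnP [d dE].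
    by have [] : d = 1%N \/ d <> 1%N by [lia|]; nia.
  apply: (mulfI e1); rewrite -subrX1 mulr0 -exprM mulnC exprM.
  by rewrite (prim_expr_order ztP) expr1n subrr.
apply: vge_sum => k _; rewrite -[0]addr0 vgeM ?vge_const //.
apply: regular_twist => //.
by rewrite -exprM mulnC exprM (prim_expr_order ztP) expr1n.
Qed.

End Kummer.

(** * Riemann-Roch spaces *)

Section RiemannRoch.
Variables (K : closedFieldType) (L : fieldExtType {fraction {poly K}}).
Local Notation place := (place (const_emb L)).
Local Notation poly_emb := (poly_emb L).
Local Notation x_sub b := (coord_x L - const_emb L b).
Implicit Types (D : place -> int) (A : divisor (const_emb L)).

(** [D] is an arbitrary function on the places, so that a bound such as the order of a fixed
    function can be used without first making it a divisor. *)
Definition bounded_space D : set L := [set z | forall P, vge P (- D P) z].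

Lemma RR_spaceE A : RR_space A = bounded_space (fun P => coeff P A).
Proof.
apply/seteqP; split=> z /= zA.
  by move=> P; rewrite /vge; case: eqVneq => //= /eqP z0; apply: zA.
by move=> /eqP z0 P; rewrite -vgeE.
Qed.

Lemma bounded_space0 D : bounded_space D 0.
Proof. by move=> P; apply: vge0. Qed.

Lemma bounded_space_lin D : lin_closed (const_emb L) (bounded_space D).
Proof.
by move=> c a b aD bD P; rewrite vgeD // -[- _]add0r vgeM ?vge_const.
Qed.

(** One dimension is lost at most because the residue field is [K]: if z attains the bound at [P0],
    then w / z is congruent there to a constant c, and w - c z meets the stricter bound. *)
Lemma has_dim_cut1 D D' P0 n :
    D' P0 = D P0 - 1 -> (forall P, P != P0 -> D' P = D P) ->
    has_dim (const_emb L) (bounded_space D) n ->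
  exists2 n', has_dim (const_emb L) (bounded_space D') n' & (n <= n'.+1)%N.
Proof.
move=> D'P0 D'P; apply: has_dim_hyperplane; try exact: bounded_space_lin.
- move=> z zD' P; apply: vgeW (zD' P).
  by have [->|/D'P ->] := eqVneq P P0; rewrite ?D'P0; lia.
- exact: bounded_space0.
move=> z w zD wD zD'.
have vz : z != 0 /\ vord P0 z = - D P0.
  have zP0 : ~~ vge P0 (- D' P0) z.
    apply/negP => h; apply: zD' => P; have [->//|/D'P ->] := eqVneq P P0; exact: zD.
  have := zD P0; move: zP0; rewrite /vge D'P0; case: eqVneq => //= z0; lia.
case: vz => z0 vz.
have [c cP] : exists c, vge P0 1 (w / z - const_emb L c).
  apply: residue; have -> : 0 = - D P0 + vord P0 z^-1 by rewrite vordV vz; lia.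
  by rewrite vgeM // vge_vord.
exists c => P; have [->|PP0] := eqVneq P P0.
  have -> : w - const_emb L c * z = (w / z - const_emb L c) * z.
    by rewrite mulrBl divfK.
  have -> : - D' P0 = 1 + vord P0 z by rewrite D'P0 vz; lia.
  by rewrite vgeM // vge_vord.
rewrite D'P // vgeB // -[- _]add0r vgeM ?vge_const //; exact: zD.
Qed.

Lemma has_dim_cut (s : seq place) D D' n : uniq s ->
    (forall P, P \in s -> D' P <= D P) -> (forall P, P \notin s -> D' P = D P) ->
    has_dim (const_emb L) (bounded_space D) n ->
  exists2 n', has_dim (const_emb L) (bounded_space D') n' &
    n%:Z <= n'%:Z + \sum_(P <- s) (D P - D' P).
Proof.
elim: s D n => [|P0 s IHs] D n /=.
  move=> _ _ D'E dimD; exists n; last by rewrite big_nil addr0.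
  by suff -> : D' = D by []; apply/funext => P; apply: D'E.
move=> /andP[P0s us] D'le D'E dimD.
pose D1 k P := if P == P0 then D P0 - (k : nat)%:Z else D P.
have cutk k : exists2 n', has_dim (const_emb L) (bounded_space (D1 k)) n' & (n <= n' + k)%N.
  elim: k => [|k [n1 dim1 le1]].
    exists n; last by rewrite addn0.
    suff -> : D1 0%N = D by []; apply/funext => P; rewrite /D1.
    by case: eqVneq => // ->; rewrite subr0.
  have [|P PP0|n2 dim2 le2] := @has_dim_cut1 (D1 k) (D1 k.+1) P0 n1 _ _ dim1.
  - by rewrite /D1 eqxx; lia.
  - by rewrite /D1 (negPf PP0).
  - by exists n2 => //; lia.
have le0 := D'le P0 (mem_head _ _).
have [n1 dim1 le1] := cutk `|D P0 - D' P0|%N.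
have [P Ps|P Ps|n2 dim2 le2] := IHs _ n1 us _ _ dim1.
- rewrite /D1; have [PP0|_] := eqVneq P P0; first by rewrite -PP0 Ps in P0s.
  by apply: D'le; rewrite inE Ps orbT.
- rewrite /D1; have [->|PP0] := eqVneq P P0; first by lia.
  by apply: D'E; rewrite inE negb_or PP0.
exists n2 => //; rewrite big_cons.
have -> : \sum_(P <- s) (D P - D' P) =
    \sum_(P <- s) (D1 `|D P0 - D' P0|%N P - D' P).
  apply: eq_big_seq => P Ps; rewrite /D1; case: eqVneq => // PP0.
  by rewrite -PP0 Ps in P0s.
by lia.
Qed.

Lemma ell_eq A n : has_dim (const_emb L) (RR_space A) n -> ell A = n.
Proof.
move=> dimA; apply: xget_subset1 => //.
by move=> k k' dk dk'; apply: has_dim_inj dk dk'.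
Qed.

Lemma genus_eq (g : int) : is_genus (const_emb L) g -> genus (const_emb L) = g.
Proof.
move=> gg; apply: xget_subset1 => // a b [[A aE] aM] [[B bE] bM].
by apply/eqP; rewrite eq_le {1}aE bM bE aM.
Qed.

Lemma deg_sum A (s : seq place) : uniq s -> (forall P, P \notin s -> coeff P A = 0) ->
  deg A = \sum_(P <- s) coeff P A.
Proof.
move=> us sA; rewrite -{1}[A]freeg_sumE raddf_sum /=.
under eq_bigr do rewrite degU.
rewrite [RHS](bigID (mem (dom A))) /= [X in _ + X]big1 ?addr0.
  rewrite -[RHS]big_filter; apply: perm_big; apply: uniq_perm.
  - exact: uniq_dom.
  - exact: filter_uniq.
  move=> P; rewrite mem_filter; have [PA|//] := boolP (P \in dom A).
  symmetry; rewrite mem_dom in PA; apply: contraNT PA => Ps.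
  by rewrite sA.
by move=> P; apply: coeff_outdom.
Qed.

(** Each place over [b] contributes at least 1 to a sum bounded by the degree, so there cannot be
    arbitrarily many. *)
Lemma places_over b : exists2 s : seq place, uniq s &
  forall P, (P \in s) = (0 < vord P (x_sub b)).
Proof.
apply: contrapT => nfin.
have long k : exists s : seq place,
    [/\ uniq s, size s = k & forall P, P \in s -> 0 < vord P (x_sub b)].
  elim: k => [|k [s [us ss sb]]]; first by exists [::].
  have [P Ps vb] : exists2 P : place, P \notin s & 0 < vord P (x_sub b).
    apply: contrapT => nP; apply: nfin; exists s => // P.
    apply/idP/idP => [/sb//|vb]; apply: contrapT => /negP Ps; apply: nP.
    by exists P.
  exists (P :: s); split=> [||P']; rewrite /= ?Ps ?ss //.
  by rewrite inE => /predU1P[-> //|/sb].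
have [s [us ss sb]] := long (\dim {:L}).+1.
have := sum_ramification_leq us sb; rewrite leNgt => /negP; apply.
rewrite -lezD1 -addn1 in ss *.
have -> : (\dim {:L})%:Z + 1 = \sum_(P <- s) 1.
  by rewrite big_const_seq count_predT ss iter_addr_0 natz PoszD.
by rewrite !big_seq; apply: ler_sum => P /sb; lia.
Qed.

End RiemannRoch.

(** * The Weierstrass semigroup at infinity *)

Section RegularRational.
Variables (K : closedFieldType) (L : fieldExtType {fraction {poly K}}).
Local Notation place := (place (const_emb L)).
Local Notation x_sub b := (coord_x L - const_emb L b).

(** One place over each point is enough: a root b of the denominator must be a root of the
    numerator, as otherwise the fraction has a pole at that place; then x - b cancels. *)
Lemma regular_rational_poly a :
    (forall b, exists2 P : place, 0 < vord P (x_sub b) & vge P 0 (frac_emb L a)) ->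
  exists p, frac_emb L a = poly_emb L p.
Proof.
have [n [d [d0 ->]]] := fracP L a.
have [k] := ubnP (size d); elim: k => // k IHk in n d d0 *.
rewrite ltnS => sdk reg.
have [/size1_polyC dE|sd] := leqP (size d) 1.
  exists ((d`_0)^-1 *: n); rewrite -mul_polyC rmorphM mulrC; congr (_ * _).
  by rewrite {1}dE !poly_embC fmorphV.
have /closed_rootP [b db] : size d != 1 by rewrite neq_ltn sd orbT.
have [P vb vnd] := reg b.
have [d' dE] := factor_theorem _ _ db.
have d'0 : d' != 0 by apply: contra_neq d0 => d'0; rewrite dE d'0 mul0r.
have nb : n.[b] = 0.
  apply: contrapT => /eqP nb; have n0 : n != 0 by apply: contra_neq nb => ->; rewrite horner0.
  have nx0 : poly_emb L n != 0 by rewrite poly_emb_eq0.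
  have dx0 : poly_emb L d != 0 by rewrite poly_emb_eq0.
  move: vnd; rewrite vgeE; last exact: mulf_neq0 nx0 (invr_neq0 dx0).
  rewrite (vord_div _ nx0 dx0) (vord_poly_unit vb nb) dE rmorphM poly_embXsubC.
  rewrite vordM ?coord_xB_neq0 ?poly_emb_eq0 //.
  have := vge_poly d' (vord_coord_x_ge0 vb); rewrite vgeE ?poly_emb_eq0 //.
  by lia.
have /factor_theorem [n' nE] : root n b by apply/rootP.
have quoE : poly_emb L n / poly_emb L d = poly_emb L n' / poly_emb L d'.
  rewrite nE dE !rmorphM poly_embXsubC invfM mulrACA divff ?coord_xB_neq0 //.
  by rewrite mulr1.
rewrite quoE; apply: IHk => //; last by move=> b'; rewrite -quoE.
by apply: leq_trans sdk; rewrite dE size_Mmonic ?monicXsubC // size_XsubC addn2.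
Qed.

End RegularRational.

Section Semigroup.
Variables (K : closedFieldType) (L : fieldExtType {fraction {poly K}}).
Variables (m r : nat) (alpha : 'I_r -> K) (lambda : 'I_r -> nat) (y : L).
Local Notation place := (place (const_emb L)).
Local Notation frac_emb := (frac_emb L).
Local Notation poly_emb := (poly_emb L).
Local Notation x_sub b := (coord_x L - const_emb L b).
Local Notation lambda0 := (\sum_(i < r) lambda i)%N.

Hypothesis m_gt0 : (0 < m)%N.
Hypothesis alpha_inj : injective alpha.
Hypothesis coprime_m : coprime m lambda0.
Hypothesis yE : y ^+ m = \prod_(i < r) x_sub (alpha i) ^+ lambda i.
Hypothesis genL : <<1; y>>%VS = fullv.
Variable Qinf : place.
Hypothesis Qinf_lt0 : vord Qinf (coord_x L) < 0.
Hypothesis m_unit : m%:R != 0 :> K.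

Let y0 : y != 0 := y_neq0 m_gt0 yE.
Let vQx : vord Qinf (coord_x L) = - m%:Z.
Proof. by case: (vord_xy_infinite m_gt0 coprime_m yE genL Qinf_lt0). Qed.
Let vQy : vord Qinf y = - lambda0%:Z.
Proof. by case: (vord_xy_infinite m_gt0 coprime_m yE genL Qinf_lt0). Qed.

(* The smallest element of the Weierstrass semigroup congruent to
   b * lambda0 modulo m. *)
Definition apery (b : nat) : nat := \sum_(i < r) ((b * lambda i) %% m).

(* y ^ b / kummer_den b is regular at every finite place, and generates over
   K[x] the regular functions in K(x) y ^ b. *)
Definition kummer_den b : {poly K} :=
  \prod_(i < r) ('X - (alpha i)%:P) ^+ (b * lambda i %/ m).

Lemma kummer_den_neq0 b : poly_emb (kummer_den b) != 0.
Proof.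
rewrite poly_emb_eq0; apply/prodf_neq0 => i _.
by rewrite expf_neq0 ?polyXsubC_eq0.
Qed.

Lemma vord_kummer_den (P : place) b : vord P (poly_emb (kummer_den b)) =
  \sum_(i < r) (b * lambda i %/ m)%N%:Z * vord P (x_sub (alpha i)).
Proof.
rewrite rmorph_prod vord_prod => [|i].
  by apply: eq_bigr => i _; rewrite rmorphXn poly_embXsubC vordX.
by rewrite rmorphXn poly_embXsubC expf_neq0 ?coord_xB_neq0.
Qed.

(** The factor m turns the floors into m floor(b lambda_i / m) = b lambda_i - (b lambda_i mod m) and
    lets [vord_y] be applied. *)
Lemma mul_vord_kummer_den (P : place) b : m%:Z * vord P (poly_emb (kummer_den b)) =
  m%:Z * (b%:Z * vord P y) -
    \sum_(i < r) ((b * lambda i) %% m)%N%:Z * vord P (x_sub (alpha i)).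
Proof.
rewrite mulrCA (vord_y yE) vord_kummer_den !mulr_sumr -sumrB.
apply: eq_bigr => i _; rewrite !mulrA -mulrBl; congr (_ * _).
by have := divn_eq (b * lambda i) m; lia.
Qed.

Lemma vordQ_den b : vord Qinf (poly_emb (kummer_den b)) =
  (apery b)%:Z - b%:Z * lambda0%:Z.
Proof.
apply: (@mulfI _ m%:Z); first by lia.
rewrite mul_vord_kummer_den vQy; under [X in _ - X]eq_bigr do rewrite vord_xB_infinite // vQx.
rewrite -mulr_suml; have -> : \sum_(i < r) ((b * lambda i) %% m)%N%:Z = (apery b)%:Z.
  by rewrite -[RHS]natz natr_sum; apply: eq_bigr => i _; rewrite natz.
by ring.
Qed.

Lemma regular_monomial b n : exists2 z, z != 0 &
  regular z /\ vord Qinf z = - (apery b + m * n)%N%:Z.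
Proof.
have h0 := kummer_den_neq0 b.
have x0 := coord_x_neq0 L.
have xyn0 : coord_x L ^+ n * y ^+ b != 0 by rewrite mulf_neq0 ?expf_neq0.
exists (coord_x L ^+ n * y ^+ b / poly_emb (kummer_den b)).
  exact: mulf_neq0 xyn0 (invr_neq0 h0).
split=> [P vx|].
  rewrite vgeE; last exact: mulf_neq0 xyn0 (invr_neq0 h0).
  rewrite (vord_div _ xyn0 h0) vordM ?expf_neq0 // !vordX.
  rewrite -(pmulr_rge0 _ (_ : 0 < m%:Z)) // mulrBr mul_vord_kummer_den mulrDr.
  set s := \sum_(i < r) _; suff : 0 <= s by nia.
  apply: sumr_ge0 => i _; rewrite mulr_ge0 //.
  rewrite -vgeE ?coord_xB_neq0 // vgeB ?vge_const //.
  by rewrite vgeE.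
rewrite (vord_div _ xyn0 h0) vordM ?expf_neq0 // !vordX vordQ_den vQx vQy.
by lia.
Qed.

(** At a place over beta where x - beta has order e, the rational function c [kummer_den b] has
    order n e. Regularity of c y^b gives m n e >= -s with s <= (m - 1) e, so the integer n cannot be
    negative. *)
Lemma regular_term_poly (c : {fraction {poly K}}) b : c != 0 ->
    regular (frac_emb c * y ^+ b) ->
  exists2 p, p != 0 & frac_emb c * poly_emb (kummer_den b) = poly_emb p.
Proof.
move=> c0 reg; pose a := c * FracField.tofrac (kummer_den b).
have aE : frac_emb a = frac_emb c * poly_emb (kummer_den b) by rewrite rmorphM.
have cx0 : frac_emb c != 0 by apply: frac_emb_neq0.
have h0 := kummer_den_neq0 b.
have ax0 : frac_emb a != 0 by rewrite aE; apply: mulf_neq0.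
have a0 : a != 0 by apply: contra_neq ax0 => ->; rewrite rmorph0.
have [|p pE] := @regular_rational_poly _ L a; last first.
  by exists p; rewrite -?aE // -(poly_emb_eq0 L) -pE.
move=> beta; have [P vb] := place_above L beta; exists P => //.
have [n nE] := vord_frac L beta a0; rewrite vgeE // nE //.
have := reg P (vord_coord_x_ge0 vb); rewrite vgeE ?mulf_neq0 ?expf_neq0 //.
rewrite (vord_term m_gt0 yE P b c0) => cy.
have := mul_vord_kummer_den P b; have := nE P vb; rewrite aE vordM //.
set e := vord P (x_sub beta) in vb *; set s := \sum_(i < r) _ => ne he.
(* The [alpha i] are distinct, so at most one summand is nonzero, and its residue is at most m -
   1. *)
have s_le : s <= (m%:Z - 1) * e.
  have [[i ib]|nb] := pselect (exists i, alpha i = beta).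
    rewrite /s (bigD1 i) //= big1 ?addr0 => [|k ki].
      rewrite ib -/e; apply: ler_wpM2r; first exact: ltW.
      by have := ltn_mod (b * lambda i) m; rewrite m_gt0; lia.
    rewrite (vord_coord_xB vb) ?mulr0 //.
    by rewrite -ib (inj_eq alpha_inj) eq_sym.
  rewrite /s big1 => [|k _]; first by apply: mulr_ge0; [lia | exact: ltW].
  rewrite (vord_coord_xB vb) ?mulr0 //.
  by apply/eqP => bk; apply: nb; exists k.
have n_ge0 : 0 <= n.
  rewrite leNgt; apply/negP => n_lt0.
  have : n * e <= - e by nia.
  have : - (m%:Z - 1) * e <= m%:Z * (n * e) by rewrite -ne mulrDr he; nia.
  by nia.
by apply: mulr_ge0 => //; apply: ltW.
Qed.

Lemma regular_vord z : z != 0 -> regular z ->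
  exists (b : 'I_m) n, vord Qinf z = - (apery b + m * n)%N%:Z.
Proof.
move=> z0 reg.
have [c zE [b cb ->]] := vord_decomposition m_gt0 coprime_m yE genL Qinf_lt0 z0.
rewrite zE in reg.
have := regular_component m_gt0 coprime_m yE genL Qinf_lt0 m_unit b reg.
move=> /(regular_term_poly cb) [p p0 pE]; exists b, (size p).-1.
have cx0 : frac_emb (c b) != 0 by apply: frac_emb_neq0.
have := congr1 (vord Qinf) pE; rewrite vordM ?kummer_den_neq0 //.
rewrite vordQ_den (vord_poly_infinite Qinf_lt0 p0) vQx.
by rewrite (vord_term m_gt0 yE Qinf b cb) vQy; lia.
Qed.

Let neq_Q (P : place) : (P != Qinf) = (0 <= vord P (coord_x L)).
Proof. exact: (neq_QinfE m_gt0 coprime_m yE genL Qinf_lt0). Qed.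

Lemma semigroupP s : weierstrass_semigroup Qinf s <->
  exists (b : 'I_m) n, s = (apery b + m * n)%N.
Proof.
split=> [[z z0 zs]|[b [n ->]]].
  have reg : regular z.
    move=> P; rewrite -neq_Q => PQ; rewrite vgeE //.
    have := zs P; rewrite coeffU eq_sym (negPf PQ) mulr0; lia.
  have [b [n vz]] := regular_vord z0 reg; exists b, n.
  have := zs Qinf; rewrite coeffU eqxx mulr1 vz; lia.
have [z z0 [reg vz]] := regular_monomial b n; exists z => // P.
rewrite coeffU; have [<-|] := eqVneq Qinf P; first by rewrite vz mulr1; lia.
rewrite eq_sym neq_Q mulr0 => /reg; rewrite vgeE //; lia.
Qed.

End Semigroup.

(** * The genus *)

(** A boolean form of membership in H(Q_infty), so that elements and gaps are counted by sums. *)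
Definition apery_semigroup (m r : nat) (lambda : 'I_r -> nat) (s : nat) : bool :=
  [exists b : 'I_m, (apery m lambda b <= s)%N && (m %| s - apery m lambda b)%N].

Section Genus.
Variables (K : closedFieldType) (L : fieldExtType {fraction {poly K}}).
Variables (m r : nat) (alpha : 'I_r -> K) (lambda : 'I_r -> nat) (y : L).
Local Notation place := (place (const_emb L)).
Local Notation frac_emb := (frac_emb L).
Local Notation poly_emb := (poly_emb L).
Local Notation x_sub b := (coord_x L - const_emb L b).
Local Notation lambda0 := (\sum_(i < r) lambda i)%N.

Hypothesis m_gt0 : (0 < m)%N.
Hypothesis alpha_inj : injective alpha.
Hypothesis coprime_m : coprime m lambda0.
Hypothesis yE : y ^+ m = \prod_(i < r) x_sub (alpha i) ^+ lambda i.
Hypothesis genL : <<1; y>>%VS = fullv.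
Variable Qinf : place.
Hypothesis Qinf_lt0 : vord Qinf (coord_x L) < 0.
Hypothesis m_unit : m%:R != 0 :> K.

Let neq_Q (P : place) : (P != Qinf) = (0 <= vord P (coord_x L)).
Proof. exact: (neq_QinfE m_gt0 coprime_m yE genL Qinf_lt0). Qed.
Let vQx : vord Qinf (coord_x L) = - m%:Z.
Proof. by case: (vord_xy_infinite m_gt0 coprime_m yE genL Qinf_lt0). Qed.
Let sg := apery_semigroup m lambda.
Let gaps M := (\sum_(s < M) ~~ sg s)%N.

Let sgP s : reflect (exists (b : 'I_m) n, s = (apery m lambda b + m * n)%N) (sg s).
Proof.
apply: (iffP existsP) => [[b /andP[bs /dvdnP[n nE]]]|[b [n ->]]]; exists b.
  by exists n; rewrite mulnC -nE subnKC.
by rewrite leq_addr addKn dvdn_mulr.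
Qed.

Lemma mem_semigroup s : weierstrass_semigroup Qinf s <-> sg s.
Proof.
split=> [/(semigroupP m_gt0 alpha_inj coprime_m yE genL Qinf_lt0 m_unit)/sgP //|/sgP].
by move/(semigroupP m_gt0 alpha_inj coprime_m yE genL Qinf_lt0 m_unit).
Qed.

Definition pole_bound (M : int) (P : place) : int := if P == Qinf then M else 0.

Lemma pole_spaceP (M : int) (z : L) :
  bounded_space (pole_bound M) z <-> regular z /\ vge Qinf (- M) z.
Proof.
split=> [zM|[reg vz] P]; rewrite /pole_bound.
  split=> [P|]; last by have := zM Qinf; rewrite /pole_bound eqxx.
  by rewrite -neq_Q => /negPf PQ; have := zM P; rewrite /pole_bound PQ oppr0.
by have [->//|] := eqVneq P Qinf; rewrite neq_Q oppr0 => /reg.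
Qed.

(** The shift by 1 starts the induction at L(-Q_infty) = 0. Passing from M - 1 to M adds a dimension
    exactly when some regular function has pole order M, again because residues lie in [K]. *)
Lemma pole_space_dim M : has_dim (const_emb L)
  (bounded_space (pole_bound (M%:Z - 1))) (\sum_(s < M) sg s).
Proof.
elim: M => [|M IHM].
  rewrite big_ord0; have -> : bounded_space (pole_bound (0%:Z - 1)) = [set 0].
    apply/seteqP; split=> z; last by move=> ->; apply: bounded_space0.
    move=> /pole_spaceP [reg vz]; apply: contrapT => /eqP z0.
    have [b [n vE]] := regular_vord m_gt0 alpha_inj coprime_m yE genL Qinf_lt0 m_unit z0 reg.
    by move: vz; rewrite vgeE // vE; lia.
  exact: has_dim0.
have -> : M.+1%:Z - 1 = M%:Z by lia.
rewrite big_ord_recr /=; have [sM|sM] := boolP (sg M); last first.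
  rewrite addn0; suff -> : bounded_space (pole_bound M) = bounded_space (pole_bound (M%:Z - 1)).
    exact: IHM.
  apply/seteqP; split=> z /pole_spaceP [reg vz]; apply/pole_spaceP; split=> //; last first.
    by apply: vgeW vz; lia.
  have [->|z0] := eqVneq z 0; first exact: vge0.
  move: vz; rewrite !vgeE // => vz.
  have [b [n vE]] := regular_vord m_gt0 alpha_inj coprime_m yE genL Qinf_lt0 m_unit z0 reg.
  suff : M <> (apery m lambda b + m * n)%N by lia.
  by move=> ME; move/negP: sM; apply; apply/sgP; exists b, n.
rewrite addn1; have [b [n ME]] := sgP _ sM.
have [z0 z0n [reg vz0]] := regular_monomial m_gt0 coprime_m yE genL Qinf_lt0 m_unit b n.
rewrite -ME in vz0; apply: (has_dim_extend (z0 := z0)) IHM; first exact: bounded_space_lin.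
- by move=> z /pole_spaceP [regz vz]; apply/pole_spaceP; split=> //; apply: vgeW vz; lia.
- by apply/pole_spaceP; split=> //; rewrite vgeE // vz0.
- by move=> /pole_spaceP [_]; rewrite vgeE // vz0; lia.
move=> w /pole_spaceP [regw vw].
have [c cP] : exists c, vge Qinf 1 (w / z0 - const_emb L c).
  apply: residue; have -> : 0 = - M%:Z + vord Qinf z0^-1 by rewrite vordV vz0; lia.
  by rewrite vgeM // vge_vord.
exists c; apply/pole_spaceP; split=> [P vx|].
  rewrite vgeB ?regw // -[0]addr0 vgeM ?vge_const //; exact: reg.
have -> : w - const_emb L c * z0 = (w / z0 - const_emb L c) * z0.
  by rewrite mulrBl divfK.
have -> : - (M%:Z - 1) = 1 + vord Qinf z0 by rewrite vz0; lia.
by rewrite vgeM // vge_vord.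
Qed.

Variable g : nat.
Hypothesis gaps_leq : forall M, (gaps M <= g)%N.

Let sum_gaps M : (\sum_(s < M) sg s + gaps M)%N = M.
Proof.
rewrite /gaps -big_split /= (eq_bigr (fun=> 1%N)) => [|s _]; last by case: (sg s).
by rewrite sum1_card card_ord.
Qed.

Lemma pole_space_riemann (M : int) : exists2 n,
  has_dim (const_emb L) (bounded_space (pole_bound M)) n & M + 1 - g%:Z <= n%:Z.
Proof.
have [M_ge|M_lt] := leP (-1) M.
  have [k kE] : exists k : nat, M = k%:Z - 1 by exists `|(M + 1)%R|%N; lia.
  exists (\sum_(s < k) sg s)%N; first by rewrite kE; apply: pole_space_dim.
  by have := sum_gaps k; have := gaps_leq k; lia.
exists 0%N; last by lia.
suff -> : bounded_space (pole_bound M) = bounded_space (pole_bound (0%:Z - 1)).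
  by have := pole_space_dim 0; rewrite big_ord0.
apply/seteqP; split=> z /pole_spaceP [reg vz]; apply/pole_spaceP; split=> //.
  by apply: vgeW vz; lia.
have [->|z0] := eqVneq z 0; first exact: vge0.
have [b [n vE]] := regular_vord m_gt0 alpha_inj coprime_m yE genL Qinf_lt0 m_unit z0 reg.
by move: vz; rewrite !vgeE // vE; lia.
Qed.

Lemma riemann_inequality (A : divisor (const_emb L)) :
  deg A - (ell A)%:Z + 1 <= g%:Z.
Proof.
pose N : int := coeff Qinf A.
have /choice [ctr ctrP] : forall P : place, exists b, P != Qinf -> 0 < vord P (x_sub b).
  move=> P; have [->|PQ] := eqVneq P Qinf; first by exists 0.
  by move: PQ; rewrite neq_Q => /place_center [b vb]; exists b.
have /choice [Sb SbP] : forall b, exists s : seq place, uniq s /\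
    forall P, (P \in s) = (0 < vord P (x_sub b)).
  by move=> b; have [s us sE] := places_over L b; exists s.
pose T := undup [seq ctr P | P <- dom A & P != Qinf].
have uT : uniq T by apply: undup_uniq.
pose k := (\sum_(P <- dom A) `|coeff P A|)%N.
pose h := \prod_(b <- T) x_sub b ^+ k.
have h0 : h != 0.
  rewrite prodf_seq_neq0; apply/allP => b _.
  by rewrite expf_neq0 ?coord_xB_neq0.
have vh (P : place) : vord P h = \sum_(b <- T) k%:Z * vord P (x_sub b).
  rewrite vord_prod => [|b]; last by rewrite expf_neq0 ?coord_xB_neq0.
  by apply: eq_bigr => b _; rewrite vordX.
have vb_ge0 P b : P != Qinf -> 0 <= vord P (x_sub b).
  rewrite neq_Q => vx; rewrite -vgeE ?coord_xB_neq0 // vgeB ?vge_const //.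
  by rewrite vgeE ?coord_x_neq0.
have vh1 (P : place) b : b \in T -> 0 < vord P (x_sub b) -> vord P h = k%:Z * vord P (x_sub b).
  move=> bT vb; rewrite vh (bigD1_seq b) //= big1 ?addr0 // => b' b'b.
  by rewrite (vord_coord_xB vb) ?mulr0 // eq_sym.
(* All places over the centers [T]: these contain every finite place in the support of [A]. *)
pose S := flatten [seq Sb b | b <- T].
have SP P : reflect (exists2 b, b \in T & 0 < vord P (x_sub b)) (P \in S).
  apply: (iffP flatten_mapP) => -[b bT]; first by rewrite (SbP b).2; exists b.
  by rewrite -(SbP b).2; exists b.
have uS : uniq S.
  rewrite /S; elim: T uT {h h0 vh vh1 S SP} => //= b T' IHT /andP[bT' uT'].
  rewrite cat_uniq (SbP b).1 IHT // andbT; apply/hasPn => P /flatten_mapP [b' b'T'].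
  rewrite (SbP b').2 => vb'; rewrite (SbP b).2 (vord_coord_xB vb') //.
  by apply: contraNneq bT' => <-.
have SQ P : P \in S -> P != Qinf.
  by move=> /SP [b _ /vord_coord_x_ge0]; rewrite neq_Q.
have domS P : P != Qinf -> P \notin S -> coeff P A = 0.
  move=> PQ PS; apply: coeff_outdom; apply: contra PS => PA; apply/SP.
  exists (ctr P); last exact: ctrP.
  by rewrite mem_undup map_f // mem_filter PQ.
(* [h] has a pole of order m k |T| at [Qinf], so division by [h] turns the bound [M] there into [N],
   the coefficient of [A]. *)
pose M := N + m%:Z * (k * size T)%N%:Z.
have [n0 + n0M] := pole_space_riemann M.
move=> /(has_dim_scale h0); set W := (W in has_dim _ W) => dimW.
pose D P := if P == Qinf then N else vord P h.
have WE : W = bounded_space D.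
  have vQh : vord Qinf h = N - M.
    rewrite vh; under eq_bigr do rewrite vord_xB_infinite // vQx.
    by rewrite big_const_seq count_predT iter_addr_0 -mulr_natr natz /M; lia.
  apply/seteqP; split=> z /= zW P; have := zW P; rewrite /D /pole_bound.
    case: eqVneq => [->|_]; last by rewrite oppr0 -(addrN (vord P h)) vgeMl.
    have -> : - M = vord Qinf h + - N by rewrite vQh; lia.
    by rewrite vgeMl.
  case: eqVneq => [->|_]; last by rewrite oppr0 -(addrN (vord P h)) vgeMl.
  have -> : - M = vord Qinf h + - N by rewrite vQh; lia.
  by rewrite vgeMl.
rewrite WE in dimW.
have [P PS|P PS|n1 dimA n01] := has_dim_cut (D' := fun P => coeff P A) uS _ _ dimW.
- have [b bT vb] := SP P PS; rewrite /D (negPf (SQ P PS)) (vh1 P b) //.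
  have : (`|coeff P A| <= k)%N.
    have [PA|/coeff_outdom ->//] := boolP (P \in dom A).
    by rewrite /k (bigD1_seq P) ?uniq_dom //= leq_addr.
  by nia.
- rewrite /D; case: eqVneq => [->//|PQ]; rewrite domS // vh big1_seq // => b /= bT.
  have [vb|vb] := leP (vord P (x_sub b)) 0; last by case/SP: PS; exists b.
  have -> : vord P (x_sub b) = 0 by have := vb_ge0 P b PQ; lia.
  by rewrite mulr0.
rewrite -RR_spaceE in dimA; rewrite (ell_eq dimA).
have degA : deg A = N + \sum_(P <- S) coeff P A.
  rewrite (@deg_sum _ _ A (Qinf :: S)) ?big_cons //.
    by rewrite /= uS andbT; apply/negP => /SQ; rewrite eqxx.
  by move=> P; rewrite inE negb_or => /andP[]; apply: domS.
(* The cuts cost at most the sum over [S] of D - A. The part coming from [D] is covered by the m k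
   |T| added to [N] in [M], and what remains is deg A + 1 - g. *)
have sumS : \sum_(P <- S) D P <= m%:Z * (k * size T)%N%:Z.
  rewrite /S big_flatten big_map.
  have -> : m%:Z * (k * size T)%N%:Z = \sum_(b <- T) (m * k)%N%:Z.
    by rewrite big_const_seq count_predT iter_addr_0 -mulr_natr natz; lia.
  rewrite big_seq [X in _ <= X]big_seq; apply: ler_sum => b bT.
  have -> : \sum_(P <- Sb b) D P = k%:Z * \sum_(P <- Sb b) vord P (x_sub b).
    rewrite mulr_sumr; apply: eq_big_seq => P; rewrite (SbP b).2 => vb.
    by rewrite /D (negPf (SQ P _)) ?(vh1 P b) //; apply/SP; exists b.
  have Sb_gt0 P : P \in Sb b -> 0 < vord P (x_sub b) by rewrite (SbP b).2.
  have sum_le := sum_ramification_leq (SbP b).1 Sb_gt0.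
  rewrite PoszM mulrC ler_wpM2r //; apply: le_trans sum_le _.
  by rewrite lez_nat (dim_leq m_gt0 yE genL).
rewrite sumrB in n01; rewrite /M in n0M; rewrite degA.
move: n01 n0M sumS; move: (\sum_(i <- S) D i) (\sum_(i <- S) coeff i A) => X Y.
by move: (m%:Z * _) => Z; lia.
Qed.

(** When all [g] gaps are below [M], the divisor (M - 1) Q_infty has dimension M - g and attains
    equality in Riemann's inequality. *)
Lemma kummer_genus M : gaps M = g -> genus (const_emb L) = g%:Z.
Proof.
move=> gM; apply: genus_eq; split; last exact: riemann_inequality.
exists << (M%:Z - 1) *g Qinf >>.
have dimA : has_dim (const_emb L) (RR_space << (M%:Z - 1) *g Qinf >>) (\sum_(s < M) sg s).
  rewrite RR_spaceE; have := pole_space_dim M; congr (has_dim _ (bounded_space _) _).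
  apply/funext => P; rewrite coeffU /pole_bound eq_sym.
  by case: eqVneq; rewrite ?mulr1 ?mulr0.
by rewrite (ell_eq dimA) degU; have := sum_gaps M; lia.
Qed.

End Genus.

(** * Gaps of the semigroup *)

Section Arithmetic.
Local Open Scope nat_scope.

Lemma sum_nat_blocks (m T : nat) (f : nat -> nat) :
  \sum_(s < m * T.+1) f s = \sum_(s < m * T) f s + \sum_(s < m) f (s + m * T).
Proof.
rewrite -!(big_mkord xpredT) mulnS addnC (@big_cat_nat _ _ _ (m * T)) ?leq_addr //=.
by congr (_ + _); rewrite -{1}[m * T]add0n big_addn addKn big_mkord.
Qed.

Lemma sum_multiples (m d : nat) : 0 < m -> \sum_(b < m * d) (m %| b) = d.
Proof.
move=> m0; elim: d => [|d IHd]; first by rewrite muln0 big_ord0.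
rewrite (sum_nat_blocks m d (fun b => m %| b)) IHd -addn1; congr (_ + _).
rewrite (bigD1 (Ordinal m0)) //= add0n dvdn_mulr // big1 ?addn0 // => b b0.
rewrite dvdn_addl ?dvdn_mulr //; apply/eqP; rewrite eqb0; apply/negP => mb.
have : 0 < b by rewrite lt0n; apply: contra b0 => /eqP b0; apply/eqP/val_inj.
by move=> /dvdn_leq /(_ mb); rewrite leqNgt ltn_ord.
Qed.

(** Pair b with m - b: the two residues add up to m, except for the gcd(m, l) values of b with m | b
    l, where both are 0. *)
Lemma sum_mod (m l : nat) : 0 < m -> 2 * (\sum_(b < m) (b * l %% m)) = m * (m - gcdn m l).
Proof.
move=> m0; set d := gcdn m l.
have d0 : 0 < d by rewrite gcdn_gt0 m0.
have dm : d %| m by apply: dvdn_gcdl.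
have dvdE b : (m %| b * l) = (m %/ d %| b).
  have dl : d %| l by apply: dvdn_gcdr.
  have -> : (m %| b * l) = (m %/ d * d %| b * (l %/ d) * d).
    by rewrite divnK // -mulnA divnK.
  rewrite dvdn_pmul2r // mulnC Gauss_dvdr //.
  by rewrite /coprime -(eqn_pmul2r d0) muln_gcdl !divnK // mul1n.
have count : \sum_(b < m) ~~ (m %| b * l) = m - d.
  have : \sum_(b < m) (m %| b * l) = d.
    under eq_bigr do rewrite dvdE.
    rewrite -[in RHS](sum_multiples d (_ : 0 < m %/ d)) ?divnK //.
    by rewrite divn_gt0 // dvdn_leq.
  have : \sum_(b < m) (m %| b * l) + \sum_(b < m) ~~ (m %| b * l) = m.
    rewrite -big_split /= (eq_bigr (fun=> 1)) => [|b _]; last by case: (m %| _).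
    by rewrite sum1_card card_ord.
  by lia.
have pair b : b <= m -> (b * l %% m) + ((m - b) * l %% m) = m * ~~ (m %| b * l).
  move=> bm; have : (b * l + (m - b) * l) %% m = 0.
    by rewrite -mulnDl subnKC // modnMr.
  rewrite -modnDm /dvdn; have := ltn_pmod (b * l) m0; have := ltn_pmod ((m - b) * l) m0.
  move: (b * l %% m) ((m - b) * l %% m) => u v vm um.
  have [uv|uv] := ltnP (u + v) m.
    rewrite modn_small // => uv0; have [-> ->] : u = 0 /\ v = 0 by lia.
    by rewrite muln0.
  have -> : u + v = m + (u + v - m) by lia.
  rewrite modnDl modn_small; last by lia.
  move=> uv0; have -> : (u == 0) = false by lia.
  by rewrite muln1; lia.
have shift : \sum_(b < m) (b * l %% m) = \sum_(b < m) ((m - b) * l %% m).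
  rewrite -(big_mkord xpredT (fun b => b * l %% m)).
  rewrite -(big_mkord xpredT (fun b => (m - b) * l %% m)).
  rewrite (big_ltn m0) [in RHS](big_ltn m0) mul0n mod0n subn0 modnMr !add0n.
  by rewrite big_nat_rev /=; apply: eq_bigr => b _; rewrite add1n subSS.
rewrite mul2n -addnn {2}shift -big_split /= -count big_distrr /=.
by apply: eq_bigr => b _; rewrite pair // ltnW.
Qed.

Variables (m r : nat) (lambda : 'I_r -> nat).
Hypothesis m_gt0 : 0 < m.
Hypothesis coprime_m : coprime m (\sum_(i < r) lambda i).
Local Notation ap := (apery m lambda).
Local Notation sg := (apery_semigroup m lambda).
Local Notation gaps M := (\sum_(s < M) ~~ sg s).
Local Notation g := (\sum_(b < m) ap b %/ m).

Lemma apery_mod b : ap b = b * \sum_(i < r) lambda i %[mod m].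
Proof. by rewrite /apery modn_summ -big_distrr. Qed.

Let res (b : 'I_m) : 'I_m := Ordinal (ltn_pmod (ap b) m_gt0).

Lemma apery_mod_inj (b c : 'I_m) : ap b = ap c %[mod m] -> b = c.
Proof.
rewrite !apery_mod => /eqP; wlog bc : b c / b <= c => [wl|].
  by have [/wl//|/ltnW /wl h /eqP bc] := leqP b c; apply/esym/h/eqP.
rewrite eq_sym eqn_mod_dvd ?leq_mul2r ?bc ?orbT // -mulnBl Gauss_dvdl // => dv.
apply/val_inj/eqP; rewrite eqn_leq bc /= -subn_eq0.
rewrite -(modn_small (leq_ltn_trans (leq_subr b c) (ltn_ord c))).
exact: dv.
Qed.

Let res_inj : injective res.
Proof. by move=> b c /(congr1 val) /= /apery_mod_inj. Qed.

Lemma apery_residue s : exists b : 'I_m, s = ap b %[mod m].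
Proof.
have [f _ fK] := injF_bij res_inj.
exists (f (Ordinal (ltn_pmod s m_gt0))).
by have /(congr1 val) /= := fK (Ordinal (ltn_pmod s m_gt0)).
Qed.

Lemma apery_semigroupE s (b : 'I_m) : s = ap b %[mod m] -> sg s = (ap b <= s).
Proof.
move=> sb; apply/existsP/idP => [[c /andP[cs]]|bs]; last first.
  by exists b; rewrite bs -eqn_mod_dvd // sb eqxx.
rewrite -eqn_mod_dvd // => /eqP sc.
by rewrite (@apery_mod_inj b c) // -sb.
Qed.

(** Each block of m consecutive integers meets the class of [ap b] once, and the gaps in that class
    are its members below [ap b], one in each of the first ap b / m blocks. *)
Lemma gaps_blocks T : gaps (m * T) = \sum_(b < m) minn T (ap b %/ m).
Proof.
elim: T => [|T IHT].
  by rewrite muln0 big_ord0 big1 // => b _; rewrite min0n.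
rewrite (sum_nat_blocks m T (fun s => ~~ sg s)) IHT [X in _ + X](reindex_inj res_inj) -big_split /=.
apply: eq_bigr => b _.
rewrite (@apery_semigroupE _ b) ?[_ %% m + _]addnC ?[m * T]mulnC ?modnMDl ?modn_mod //.
have := divn_eq (ap b) m; have := ltn_pmod (ap b) m_gt0.
move: (ap b %/ m) (ap b %% m) => k u um ->.
by rewrite leq_add2r leq_pmul2r //; case: leqP; lia.
Qed.

Lemma gaps_leq M : gaps M <= g.
Proof.
apply: (@leq_trans (gaps (m * M))).
  have -> : m * M = M + (m * M - M) by rewrite subnKC // leq_pmull.
  by rewrite big_split_ord leq_addr.
by rewrite gaps_blocks; apply: leq_sum => b _; apply: geq_minr.
Qed.

Lemma gaps_eq : gaps (m * g) = g.
Proof.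
rewrite gaps_blocks; apply: eq_bigr => b _; apply/minn_idPr.
by rewrite (bigD1 b) //= leq_addr.
Qed.

(** The Riemann-Hurwitz formula in additive form. It follows by summing ap b = m (ap b / m) + (ap b
    mod m) over b: [sum_mod] evaluates the left side, and the residues are a permutation of 0, ...,
    m - 1. *)
Lemma double_gaps : 2 * g + m = 1 + \sum_(i < r) (m - gcdn m (lambda i)).
Proof.
have sum_ap : 2 * \sum_(b < m) ap b = m * \sum_(i < r) (m - gcdn m (lambda i)).
  rewrite exchange_big !big_distrr /=; apply: eq_bigr => i _.
  by rewrite sum_mod.
have sum_res : 2 * \sum_(b < m) (ap b %% m) = m * (m - 1).
  have -> : m - 1 = m - gcdn m 1 by rewrite gcdn1.
  rewrite -sum_mod //; congr (2 * _); rewrite [RHS](reindex_inj res_inj) /=.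
  by apply: eq_bigr => b _; rewrite muln1 modn_mod.
have : \sum_(b < m) ap b = m * g + \sum_(b < m) (ap b %% m).
  rewrite big_distrr /= -big_split /=; apply: eq_bigr => b _.
  by rewrite mulnC -divn_eq.
move: sum_ap sum_res; move: (\sum_(b < m) ap b) (\sum_(b < m) (ap b %% m)) g.
move: (\sum_(i < r) _) => D A B G sA sB AE.
have : m * (2 * G + m) = m * (1 + D) by nia.
by move/eqP; rewrite eqn_pmul2l // => /eqP.
Qed.

End Arithmetic.

(** * The largest gap *)

Section FrobeniusNumber.
Variables (K : closedFieldType) (F : fieldType) (iota : {rmorphism K -> F}).

Lemma frobenius_number_eq (Q : place iota) n : gap_set Q n ->
  (forall k, gap_set Q k -> (k <= n)%N) -> frobenius_number Q = n%:Z.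
Proof.
move=> Qn Qmax; apply: xget_subset1; first by exists n.
move=> _ _ [k [-> Qk kmax]] [l [-> Ql lmax]]; congr Posz.
by apply/eqP; rewrite eqn_leq kmax // lmax.
Qed.

End FrobeniusNumber.

Section AperyMaximum.
Local Open Scope nat_scope.
Variables (m r : nat) (lambda : 'I_r -> nat).
Hypothesis lambda_bounds : forall i, 1 <= lambda i < m.

Lemma apery_pred : apery m lambda m.-1 + \sum_(i < r) lambda i = r * m.
Proof.
rewrite /apery -big_split /= -[r in RHS]card_ord -sum_nat_const.
apply: eq_bigr => i _; have /andP[l1 lm] := lambda_bounds i.
have -> : m.-1 * lambda i = (lambda i).-1 * m + (m - lambda i) by nia.
by rewrite modnMDl modn_small; lia.
Qed.

Lemma apery_leq b : (forall i, lambda i %| m) ->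
  apery m lambda b + \sum_(i < r) lambda i <= r * m.
Proof.
move=> dv; rewrite /apery -big_split /= -[r in leqRHS]card_ord -sum_nat_const.
apply: leq_sum => i _; have /andP[l1 lm] := lambda_bounds i.
have /dvdnP [k mE] := dv i; have k0 : 0 < k by nia.
rewrite mE -muln_modl; have := ltn_pmod b k0; nia.
Qed.

End AperyMaximum.

Theorem theorem1
  (p e q : nat) (hp : prime p) (he : (0 < e)%N) (hq : q = (p ^ e)%N)
  (Fq : finFieldType) (hFq : #|Fq| = q)
  (K : closedFieldType) (j : {rmorphism Fq -> K})
  (hK : forall z : K, algebraicOver j z)
  (m r : nat) (hm : (2 <= m)%N) (hr : (2 <= r)%N) (hpm : ~~ (p %| m)%N)
  (alpha : 'I_r -> K) (halpha : injective alpha)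
  (lambda : 'I_r -> nat) (hlambda : forall i, (1 <= lambda i < m)%N)
  (lambda0 : nat) (hlambda0 : lambda0 = (\sum_(i < r) lambda i)%N)
  (hcop : coprime m lambda0)
  (L : fieldExtType {fraction {poly K}}) (y : L)
  (hy : y ^+ m = \prod_(i < r) (coord_x L - const_emb L (alpha i)) ^+ lambda i)
  (hL : <<1; y>>%VS = fullv)
  (Qinf : place (const_emb L)) (hQinf : vord Qinf (coord_x L) < 0) :
  (frobenius_number Qinf = m%:Z * (r%:Z - 1) - lambda0%:Z
     /\ symmetric_semigroup Qinf)
  <-> (forall i : 'I_r, (lambda i %| m)%N).
Proof.
subst lambda0 q; have m_gt0 : (0 < m)%N by apply: ltnW.
have m_unit : m%:R != 0 :> K.
  by rewrite -(dvdn_pcharf (rmorph_pchar j (card_finPcharP hFq hp))).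
pose g := (\sum_(b < m) apery m lambda b %/ m)%N.
have gE : genus (const_emb L) = g%:Z.
  exact: (kummer_genus m_gt0 halpha hcop hy hL hQinf m_unit
            (gaps_leq m_gt0 hcop) (gaps_eq m_gt0 hcop)).
have memH := mem_semigroup m_gt0 halpha hcop hy hL hQinf m_unit.
have g2 : (2 * g + m = 1 + \sum_(i < r) (m - gcdn m (lambda i)))%N := double_gaps m_gt0 hcop.
have sum_gcd : (\sum_(i < r) (m - gcdn m (lambda i)) + \sum_(i < r) gcdn m (lambda i) = r * m)%N.
  rewrite -big_split /= -[r in RHS]card_ord -sum_nat_const.
  by apply: eq_bigr => i _; rewrite subnK // dvdn_leq ?dvdn_gcdl.
rewrite /symmetric_semigroup gE; split=> [[-> sym] i|dv].
  have gcd_le k : (gcdn m (lambda k) <= lambda k)%N.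
    by have /andP[l1 _] := hlambda k; rewrite dvdn_leq ?dvdn_gcdr.
  (* Both values of the Frobenius number are compared through [g2]; equality of the sums then forces
     equality in every inequality [gcd_le]. *)
  have : (\sum_(k < r) gcdn m (lambda k) == \sum_(k < r) lambda k)%N by nia.
  rewrite (leqif_sum (fun k _ => leqif_eq (gcd_le k))) => /forallP /(_ i) /=.
  by move=> /eqP <-; apply: dvdn_gcdl.
have gcdE : (\sum_(i < r) gcdn m (lambda i) = \sum_(i < r) lambda i)%N.
  by apply: eq_bigr => i _; apply/gcdn_idPr.
pose n := (r * m - \sum_(i < r) lambda i - m)%N.
(* A proper divisor of m is at most m / 2. With r >= 2 this ensures that the natural subtractions in
   [n] do not truncate. *)
have half : (2 * \sum_(i < r) lambda i <= r * m)%N.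
  rewrite big_distrr /= -[r in leqRHS]card_ord -sum_nat_const.
  apply: leq_sum => i _; have /dvdnP [k mE] := dv i; have /andP[l1 lm] := hlambda i.
  by have : (1 < k)%N; nia.
have nE : (n + m + \sum_(i < r) lambda i = r * m)%N by rewrite /n; move: half; nia.
(* Besides symmetry, this shows that [n] is odd and hence positive, as a gap must be. *)
have n_odd : (n + 1 = 2 * g)%N by move: g2 sum_gcd; rewrite gcdE; lia.
have -> : frobenius_number Qinf = n%:Z; last by move: nE n_odd; nia.
have pred_lt : (m.-1 < m)%N by rewrite ltn_predL.
have ap_pred : (apery m lambda (Ordinal pred_lt) = n + m)%N.
  by apply: (@addIn (\sum_(i < r) lambda i)); rewrite nE apery_pred.
apply: frobenius_number_eq => [|k [k_gt0 /memH nk]].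
  split; first by rewrite /=; lia.
  move=> /memH; rewrite (@apery_semigroupE _ _ _ hcop n (Ordinal pred_lt)).
    by rewrite ap_pred; lia.
  by rewrite ap_pred modnDr.
(* A gap k in the class of [apery m lambda b] lies below that element by a positive multiple of m,
   so it is at most (n + m) - m. *)
have [b kb] := apery_residue m_gt0 hcop k.
have := apery_leq hlambda b dv.
move/negP: nk; rewrite (apery_semigroupE hcop kb) -ltnNge => kap.
have : (m %| apery m lambda b - k)%N by rewrite -eqn_mod_dvd ?kb // ltnW.
by move=> /dvdn_leq; rewrite subn_gt0 => /(_ kap); lia.
Qed.
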